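(* Let $n\ge 2$. Let $\Phi$ be a Young function on $[0,\infty)$ and let $\Psi$ be an increasing $C^1$-function on $(0,\infty)$ such that there are functions $f,\varphi:[0,\infty)\to[0,\infty)$ satisfying the doubling condition and a function $\psi:(0,\infty)\to(0,\infty)$ so that $\Phi(t)=f(t)\varphi(t)$ and $\Psi(t)=f(t)\psi(t)$, and the inequalities $$f(s)\cdot f(t)\le C f(st)\qquad\text{and}\qquad \varphi(s)\cdot\psi(t)\le C\varphi(st)$$ hold for all $s,t\in(0,\infty)$ with some fixed constant $C$. Let $R>0$ be given. Then there is a constant $K$ such that the capacitary strong type inequality $$\int_0^\infty C_\Phi\big(\{x\in B^n(0,R): |u(x)|>t\}\big)\,d\Psi(t)\le K\int \Phi(|\nabla u(x)|)\,dx$$ holds for all functions $u$ belonging to the Orlicz-Sobolev space $W_0^{1,\Phi}(B^n(0,R))$; here $K$ is independent of $u$.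
   Context: $B^n(0,R)$ is the ball of radius $R$ centered at the origin of $\mathbb{R}^n$. A Young function is a continuous, strictly increasing, convex function $\Phi:[0,\infty)\to[0,\infty)$ with $\lim_{t\to0+}\Phi(t)/t=\lim_{t\to\infty}t/\Phi(t)=0$. A function $g:[0,\infty)\to[0,\infty)$ satisfies the doubling condition if there is a positive constant $C$ with $g(2t)\le Cg(t)$ for all $t\in[0,\infty)$; for a Young function this is called the $\Delta_2$-condition. Orlicz and Orlicz-Sobolev spaces: for a domain (open connected set) $G\subset\mathbb{R}^n$, $L^\Phi(G)$ is the set of measurable $u:G\to\mathbb{R}\cup\{\pm\infty\}$ such that $\int_G\Phi(|\lambda u(x)|)\,dx<\infty$ for some $\lambda>0$, with the Luxemburg norm $\|u\|_{L^\Phi(G)}=\inf\{s>0:\int_G\Phi(|u(x)/s|)\,dx\le1\}$. $W^{1,\Phi}(G)$ is the set of $u\in L^\Phi(G)$ whose first weak derivative $Du$ is in $L^\Phi(G)$, with norm $\|u\|_{L^\Phi(G)}+\|Du\|_{L^\Phi(G)}$, and $W_0^{1,\Phi}(G)$ is the closure of $C_0^\infty(G)$ in this norm. Capacity: with $R>0$ given and $\Phi$ a Young function satisfying the $\Delta_2$-condition, for any set $E\subset B^n(0,R)$, $$C_\Phi(E)=\inf\Big\{\int\Phi(|\nabla u(x)|)\,dx: u\in C_0^\infty(B^n(0,R)),\ u(x)\ge1\text{ when }x\in E\Big\}.$$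
   Formalization: The inequality is proved for those u in W_0^{1,Φ} whose extension by zero is continuous off open subsets of the ball of arbitrarily small C_Φ-capacity; without this it fails, e.g. for n=2, Φ=Ψ=t² and a sum of loglog singularities at a dense set of points. *)

(* Defs.v *)
From HB Require Import structures.
From mathcomp Require Import all_boot all_order all_algebra.
From mathcomp Require Import all_classical all_reals all_analysis.
From mathcomp Require Import measurable_realfun.

Set Implicit Arguments.
Unset Strict Implicit.
Unset Printing Implicit Defensive.

Import Order.TTheory GRing.Theory Num.Theory.
Import numFieldNormedType.Exports.

Local Open Scope classical_set_scope.
Local Open Scope ring_scope.

(* The library norm `|x| on 'rV[R]_n is the sup norm; the topology is the
   same, but lengths of vectors and balls have to be Euclidean. *)
Definition enorm {R : realType} {n : nat} (x : 'rV[R]_n) : R :=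
  Num.sqrt (\sum_(i < n) x 0 i ^+ 2).

Definition eball {R : realType} (n : nat) (r : R) : set 'rV[R]_n :=
  [set x | enorm x < r].
Arguments eball {R} n r.

Section lebesgue_outer_measure.
Context {R : realType} {n : nat}.
Local Open Scope ereal_scope.

Definition box (ab : 'rV[R]_n * 'rV[R]_n) : set 'rV[R]_n :=
  [set x | forall i, (ab.1 0 i < x 0 i <= ab.2 0 i)%R].

Definition box_volume (ab : 'rV[R]_n * 'rV[R]_n) : \bar R :=
  (\prod_(i < n) Num.max 0 (ab.2 0 i - ab.1 0 i))%R%:E.

Definition box_cover (A : set 'rV[R]_n) : set (set ('rV[R]_n * 'rV[R]_n)) :=
  [set S | countable S /\ A `<=` \bigcup_(ab in S) box ab].

Definition lebesgue_outer (A : set 'rV[R]_n) : \bar R :=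
  ereal_inf [set \esum_(ab in S) box_volume ab | S in box_cover A].

Lemma box_volume_ge0 ab : 0 <= box_volume ab.
Proof. by rewrite lee_fin prodr_ge0// => i _; rewrite le_max lexx. Qed.

Lemma lebesgue_outer_ge0 A : 0 <= lebesgue_outer A.
Proof.
apply: le_ereal_inf_tmp => _ [S _ <-].
by apply: esum_ge0 => ab _; exact: box_volume_ge0.
Qed.

Lemma lebesgue_outer0 : lebesgue_outer set0 = 0.
Proof.
apply/eqP; rewrite eq_le lebesgue_outer_ge0 andbT.
apply: ereal_inf_lbound; exists set0; last by rewrite esum_set0.
by split; [exact: countable0|exact: sub0set].
Qed.

Lemma le_lebesgue_outer : {homo lebesgue_outer : A B / A `<=` B >-> A <= B}.
Proof.
move=> A B AB; apply: ereal_inf_le_tmp => _ [S [cS BS] <-].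
by exists S => //; split => //; exact: subset_trans BS.
Qed.

Lemma lebesgue_outer_sigma_subadditive : sigma_subadditive lebesgue_outer.
Proof.
move=> A; have [[i ioo]|] := pselect (exists i, lebesgue_outer (A i) = +oo).
  rewrite (eseries_pinfty _ _ ioo) ?leey// => k _.
  by rewrite -ltNye (lt_le_trans _ (lebesgue_outer_ge0 _)).
rewrite -forallNE => Aoo.
suff H (e : {posnum R}) : lebesgue_outer (\bigcup_k A k) <=
    \sum_(i <oo) lebesgue_outer (A i) + e%:num%:E.
  by apply/lee_addgt0Pr => _/posnumP[].
rewrite (le_trans _ (epsilon_trick _ _ _))//; last first.
  by move=> k; exact: lebesgue_outer_ge0.
have [S HS] : {S : (set ('rV[R]_n * 'rV[R]_n))^nat &
    forall k, box_cover (A k) (S k) /\ \esum_(ab in S k) box_volume ab <=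
      lebesgue_outer (A k) + (e%:num / (2 ^ k.+1)%:R)%:E}.
  apply: (@choice _ _ (fun k S => box_cover (A k) S /\
    \esum_(ab in S) box_volume ab <=
      lebesgue_outer (A k) + (e%:num / (2 ^ k.+1)%:R)%:E)) => k.
  have fk : lebesgue_outer (A k) \is a fin_num.
    rewrite ge0_fin_numE ?lebesgue_outer_ge0//.
    by rewrite lt_neqAle leey andbT; apply/eqP; exact: Aoo.
  have e0 : (0 < e%:num / (2 ^ k.+1)%:R)%R by [].
  have [_ [T cT <-] /ltW lT] := lb_ereal_inf_adherent e0 fk.
  by exists T.
apply: (@le_trans _ _ (\esum_(ab in \bigcup_k S k) box_volume ab)).
  apply: ereal_inf_lbound; exists (\bigcup_k S k) => //; split.
    by apply: bigcup_countable => // k _; case: (HS k) => -[].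
  move=> x [k _ /((HS k).1.2)[ab Sab xab]].
  by exists ab => //; exists k.
rewrite [X in esum X](seqDU_bigcup_eq S) esum_bigcupT; last 2 first.
- exact: trivIset_seqDU.
- by move=> ab; exact: box_volume_ge0.
rewrite nneseries_esumT; last first.
  by move=> k; rewrite adde_ge0// lebesgue_outer_ge0.
apply: le_esum => k _; apply: le_trans (HS k).2.
apply: le_ereal_sup => _ [X [finX XS] <-]; exists X => //; split => //.
by apply: subset_trans XS _; exact: subDsetl.
Qed.

HB.instance Definition _ := isOuterMeasure.Build R 'rV[R]_n lebesgue_outer
  lebesgue_outer0 lebesgue_outer_ge0 le_lebesgue_outer
  lebesgue_outer_sigma_subadditive.

End lebesgue_outer_measure.

(* R^n with the sigma-algebra of Lebesgue (i.e. Caratheodory) measurable sets,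
   on which lebesgue_outer is a complete measure. *)
Definition Rspace (R : realType) (n : nat) :=
  caratheodory_type (@lebesgue_outer R n).

HB.instance Definition _ (R : realType) (n : nat) :=
  Measurable.copy (Rspace R n) (caratheodory_type (@lebesgue_outer R n)).

Definition lebesgue {R : realType} {n : nat} : set (Rspace R n) -> \bar R :=
  @lebesgue_outer R n.

HB.instance Definition _ (R : realType) (n : nat) :=
  isMeasure.Build _ (Rspace R n) R lebesgue
    (caratheodory_measure0 (@lebesgue_outer R n))
    (caratheodory_measure_ge0 (mu := @lebesgue_outer R n))
    (@caratheodory_measure_sigma_additive R _ (@lebesgue_outer R n)).

Section smooth_functions.
Context {R : realType} {n : nat}.

Definition partial (i : 'I_n) (f : 'rV[R]_n -> R) (x : 'rV[R]_n) : R :=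
  'D_(delta_mx 0 i) f x.

Definition gradient (f : 'rV[R]_n -> R) (x : 'rV[R]_n) : 'rV[R]_n :=
  \row_i partial i f x.

Definition smooth (f : 'rV[R]_n -> R) : Prop :=
  forall s : seq 'I_n, let g := foldr partial f s in
    continuous g /\ forall i x, derivable g x (delta_mx 0 i).

Definition Cc_infty (G : set 'rV[R]_n) : set ('rV[R]_n -> R) :=
  [set f | [/\ smooth f, compact (closure [set x | f x != 0]) &
               closure [set x | f x != 0] `<=` G]].

End smooth_functions.

Section young_functions.
Context {R : realType}.
Implicit Types Phi Psi g : R -> R.

Definition young Phi : Prop :=
  [/\ (forall t : R, 0 <= t -> 0 <= Phi t) /\ {within `[0, +oo[, continuous Phi},
      {in `[0, +oo[ &, {homo Phi : s t / s < t}},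
      convex_function (`[0, +oo[%classic : set R) (Phi : R -> R^o),
      Phi t / t @[t --> 0^'+] --> 0 &
      t / Phi t @[t --> +oo] --> 0].

Definition doubling g : Prop :=
  exists2 C : R, 0 < C & forall t : R, 0 <= t -> g (2 * t) <= C * g t.

Definition C1_pos Psi : Prop :=
  forall t : R, 0 < t -> derivable Psi t 1 /\ {for t, continuous (derive1 Psi)}.

(* Extension to the whole line by the limit at 0+ of a nondecreasing
   Psi >= 0 on ]0, +oo[; the measure below does not charge ]-oo, 0]. *)
Definition extend0 Psi (t : R) : R :=
  if 0 < t then Psi t else inf [set Psi s | s in `]0, +oo[].

(* Definitionally lebesgue_stieltjes_measure (extend0 Psi), without asking for
   a bundled proof that extend0 Psi is a cumulative function. *)
Definition stieltjes Psi : set (measurableTypeR R) -> \bar R :=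
  ((wlength (extend0 Psi))^*)%mu.

End young_functions.

Section orlicz_sobolev.
Context {R : realType} {n : nat}.
Implicit Types (Phi : R -> R) (G : set 'rV[R]_n).
Implicit Types (u : 'rV[R]_n -> \bar R) (Du : 'rV[R]_n -> 'rV[R]_n).
Local Open Scope ereal_scope.

(* er_map extends Phi by Phi(+oo) = +oo. *)
Definition modular Phi G u : \bar R :=
  \int[lebesgue]_(x in G) er_map Phi `|u x|.

Definition orlicz Phi G u : Prop :=
  measurable_fun (G : set (Rspace R n)) (u : Rspace R n -> \bar R) /\
  exists2 l : R, (0 < l)%R & modular Phi G (fun x => l%:E * u x) < +oo.

Definition luxemburg Phi G u : \bar R :=
  ereal_inf [set s%:E | s in
    [set s : R | (0 < s)%R /\ modular Phi G (fun x => s^-1%:E * u x) <= 1]].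

Definition locally_integrable_on G u : Prop :=
  forall K, compact K -> K `<=` G ->
    lebesgue.-integrable (K : set (Rspace R n)) (u : Rspace R n -> \bar R).

Definition weak_gradient G u Du : Prop :=
  [/\ locally_integrable_on G u,
      forall i, locally_integrable_on G (fun x => (Du x ord0 i)%:E) &
      forall f, Cc_infty G f -> forall i,
        \int[lebesgue]_(x in G) (u x * (partial i f x)%:E) =
        - \int[lebesgue]_(x in G) ((Du x ord0 i)%:E * (f x)%:E)].

(* Functions are carried together with (a representative of) their weak
   gradient: W1 Phi G u Du says that u is in W^{1,Phi}(G) and that Du is its
   weak derivative, and similarly for W10. *)
Definition W1 Phi G u Du : Prop :=
  [/\ orlicz Phi G u, weak_gradient G u Du,
      (forall i, measurable_fun (G : set (Rspace R n))
         ((fun x => Du x ord0 i) : Rspace R n -> R)) &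
      orlicz Phi G (fun x => (enorm (Du x))%:E)].

Definition W1_norm Phi G u Du : \bar R :=
  luxemburg Phi G u + luxemburg Phi G (fun x => (enorm (Du x))%:E).

Definition W10 Phi G u Du : Prop :=
  W1 Phi G u Du /\
  forall e : R, (0 < e)%R -> exists2 f, Cc_infty G f &
    W1_norm Phi G (fun x => u x - (f x)%:E)
                  (fun x => Du x - gradient f x)%R < e%:E.

(* ereal_inf set0 = +oo: sets without admissible function have capacity +oo. *)
Definition capacity Phi (r : R) (E : set 'rV[R]_n) : \bar R :=
  ereal_inf [set modular Phi (eball n r) (fun x => (enorm (gradient v x))%:E)
            | v in [set v | Cc_infty (eball n r) v /\
                            forall x, E x -> (1 <= v x)%R]].

(* The extension of u by 0 outside the ball is continuous off open sets of
   arbitrarily small capacity.  The capacity of a level set depends on the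
   pointwise values of u, which an element of W_0^{1,Phi} determines only almost
   everywhere; a quasicontinuous representative is needed for such capacities
   to be meaningful.  With this capacity (test functions >= 1 on all of E, no
   outer regularization) it is also a genuine restriction: test functions are
   continuous, so that C(E) = +oo as soon as E is dense in the ball. *)
Definition quasicontinuous Phi (r : R) u : Prop :=
  forall e : R, (0 < e)%R -> exists V : set 'rV[R]_n,
    [/\ open V, V `<=` eball n r, capacity Phi r V < e%:E &
        {within ~` V, continuous (u \_ (eball n r))}].

End orlicz_sobolev.

(* Main.v *)
From HB Require Import structures.
Require Import Defs.
From mathcomp Require Import all_boot all_order all_algebra.
From mathcomp Require Import all_classical all_reals all_analysis.
From mathcomp Require Import measurable_realfun.
From mathcomp Require Import ring lra.

Set Implicit Arguments.
Unset Strict Implicit.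
Unset Printing Implicit Defensive.

Import Order.TTheory GRing.Theory Num.Theory.
Import numFieldNormedType.Exports.

Local Open Scope classical_set_scope.
Local Open Scope ring_scope.

(** Write B for the ball of radius r and E(v) for the integral of Phi(|grad v|)
over B.  Multiplying the two inequalities on f, phi and psi gives
Phi(a) Psi(b) <= C^2 Phi(a b), and the doubling conditions on f and phi make
Phi doubling; the theorem follows from these two facts.

For a smooth function F the inequality is Maz'ya's truncation argument.  Let
sigma be a smooth step, equal to 0 up to 1/8 and to 1 from 1/4 on.  The
function sigma(F/t) + sigma(-F/t), called [level_cut t F], is at least 1 where
|F| >= t/4; its gradient lives on the shell t/8 < |F| < t/4 and is at most
2 L |grad F| / t there, where L bounds the derivative of sigma.  The shells of distinct powers t of 2 are disjoint, so
at each point the sum over t of Psi(2 t) Phi(|grad (level_cut t F)|) has at most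
one nonzero term, which is bounded by K Phi(|grad F|) because
Psi(2 t) Phi(|grad F| / (2 t)) <= C^2 Phi(|grad F|): this is
[sum_level_cut_le].  Since the capacity of {|u| > t} is nonincreasing in t, its
integral against dPsi is at most the corresponding dyadic sum
([integral_dyadic_le]).

It remains to pass from smooth functions to u.  The capacity of {|u| > t}
depends on the pointwise values of u, whereas smooth F approximate u only in
norm.  The bridge is [capacity_level_le]: given t and e, every F that is close
enough to u in L^1(B) satisfies
cap {|u| > t} <= D (E(level_cut t F) + e).
To see this, take an open set V of small capacity off which u is continuous and
a test function v for V.  Quasicontinuity puts {|u| > t} inside a compact subset
K of an open subset O of B on which v >= 1/4 or |u| > t/2
([quasicontinuous_level_set]).  Hence W = level_cut t F + sigma(v) satisfies
1 - W <= (4/t) |u - F| on O, so that W is at least 1 on O up to an error which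
is small in L^1.  Averaging W over a small cube turns this integral bound into a
lower bound at every point of K, and as W is uniformly continuous the average
can be replaced by a Riemann sum ([grid_average_ge]).  Such a sum is a finite
average of translates of W, hence a smooth test function, and by Jensen's
inequality its energy is controlled by that of W ([energy_shifted_average]).
Composing the translations with a dilation by some l > 1 keeps the supports
inside B ([Cc_affine]).

Only finitely many dyadic levels matter at a time, so a single F serves all of
them, and E(F) <= D (int Phi(|Du|) + int Phi(|Du - grad F|)), where the last
integral is as small as desired because F can be chosen close to u in
W^{1,Phi} ([W10_approx]). *)

(** * Lebesgue measure: open sets, affine maps and cubes *)

(** Cutting the interval ]a, b] at c preserves total length, also when
c lies outside of it or b < a. *)
Lemma max0_split (R : realType) (a b c : R) :
  Num.max 0 (b - a) = Num.max 0 (Num.min b c - a) + Num.max 0 (b - Num.max a c).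
Proof.
case: (leP b c) => bc; case: (leP a c) => ac.
- rewrite [Num.max 0 (b - c)]max_l ?addr0//; lra.
- rewrite !max_l ?addr0//; lra.
- rewrite !max_r; lra.
- by rewrite [Num.max 0 (c - a)]max_l ?add0r//; lra.
Qed.

Section outer_measure_of_boxes.
Context {R : realType} {n : nat}.
Local Open Scope ereal_scope.
Notation bx := ('rV[R]_n * 'rV[R]_n)%type.

Lemma countable_enum (T : pointedType) (S : set T) : countable S ->
  exists (e : nat -> T) (P : set nat), set_inj P e /\ S = e @` P.
Proof.
move=> /countable_injP[g ginj].
pose e k := xget point [set s | S s /\ g s = k].
have eP s : S s -> e (g s) = s.
  move=> Ss; rewrite /e; case: xgetP => [t _ [St gt]|/(_ s)/=]; last by case.
  by apply: ginj; rewrite ?inE.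
exists e, (g @` S); split.
  by move=> _ _ /set_mem[s Ss <-] /set_mem[t St <-]; rewrite !eP// => ->.
apply/seteqP; split=> [s Ss|_ [_ [s Ss <-] <-]]; last by rewrite eP.
by exists (g s); [exists s|exact: eP].
Qed.

Lemma lebesgue_outer_box_le (ab : bx) : lebesgue_outer (box ab) <= box_volume ab.
Proof.
apply: ereal_inf_lbound; exists [set ab]; last first.
  by rewrite esum_set1 ?box_volume_ge0.
by split; [exact: countable1|move=> x xab; exists ab].
Qed.

(** Covers are allowed to be indexed families, with repetitions, so that a
cover can be transformed box by box without discussing injectivity. *)
Lemma lebesgue_outer_le_esum (T : pointedType) (S : set T) (F : T -> bx)
    (A : set 'rV[R]_n) : countable S -> A `<=` \bigcup_(s in S) box (F s) ->
  lebesgue_outer A <= \esum_(s in S) box_volume (F s).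
Proof.
move=> /countable_enum[e [P [einj ->]]] AF.
rewrite esum_set_image//; last by move=> *; exact: box_volume_ge0.
rewrite eseries_mkcond.
pose B k := if k \in P then box (F (e k)) else set0.
apply: (@le_trans _ _ (lebesgue_outer (\bigcup_k B k))).
  apply: le_lebesgue_outer => x /AF[_ [k Pk <-]] xk; exists k => //.
  by rewrite /B mem_set.
apply: le_trans (lebesgue_outer_sigma_subadditive _) _.
apply: lee_nneseries => [k _ _|k _]; first exact: lebesgue_outer_ge0.
by rewrite /B; case: ifP => _; rewrite ?lebesgue_outer0 ?lebesgue_outer_box_le.
Qed.

(** Each box of a cover splits into the parts on the two sides of the hyperplane,
and the two volumes add up. *)
Lemma measurable_halfspace (i : 'I_n) (c : R) :
  measurable ([set x : 'rV[R]_n | x 0 i <= c]%R : set (Rspace R n)).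
Proof.
apply: le_caratheodory_measurable => X /=; apply: le_ereal_inf_tmp => _ [S [cS XS] <-].
pose lo (ab : bx) : bx :=
  (ab.1, \row_j (if j == i then Num.min (ab.2 0 j) c else ab.2 0 j)%R).
pose up (ab : bx) : bx :=
  ((\row_j (if j == i then Num.max (ab.1 0 j) c else ab.1 0 j)%R)%R, ab.2).
have -> : \esum_(ab in S) box_volume ab =
    \esum_(ab in S) box_volume (lo ab) + \esum_(ab in S) box_volume (up ab).
  rewrite -esumD; [|by move=> *; exact: box_volume_ge0..].
  apply: eq_esum => ab _; rewrite /box_volume /lo /up -EFinD; congr EFin.
  rewrite (bigD1 i)//= [X in (_ = X + _)%R](bigD1 i)//= [X in (_ = _ + X)%R](bigD1 i)//=.
  rewrite !mxE !eqxx.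
  rewrite (max0_split _ _ c) mulrDl; congr (_ * _ + _ * _)%R.
    by apply: eq_bigr => j ji; rewrite !mxE (negbTE ji).
  by apply: eq_bigr => j ji; rewrite !mxE (negbTE ji).
apply: leeD; apply: lebesgue_outer_le_esum => // x [/XS[ab Sab xab] xi];
  exists ab => // j; have := xab j; rewrite /= !mxE; case: eqP => //= ->.
- by rewrite le_min => /andP[-> ->]; rewrite xi.
- move/negP: xi; rewrite -ltNge => xi.
  by rewrite gt_max => /andP[-> ->]; rewrite xi.
Qed.

End outer_measure_of_boxes.

Section measurable_sets_of_Rspace.
Context {R : realType} {n : nat}.
Local Open Scope ereal_scope.

Lemma measurable_box (ab : 'rV[R]_n * 'rV[R]_n) :
  measurable (box ab : set (Rspace R n)).
Proof.
rewrite (_ : box ab = \bigcap_(i in [set: 'I_n])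
    ([set x : 'rV[R]_n | x 0 i <= ab.2 0 i]%R `\`
     [set x : 'rV[R]_n | x 0 i <= ab.1 0 i]%R)).
  apply: fin_bigcap_measurable => // i _.
  by apply: measurableD; exact: measurable_halfspace.
apply/seteqP; split => [x xab i _ /=|x xab i].
  by have /andP[xa xb] := xab i; split => //; apply/negP; rewrite -ltNge.
by have [/= xb /negP] := xab i I; rewrite -ltNge => ->.
Qed.

(** An open set is the union of the boxes with rational corners that it
contains. *)
Lemma open_measurable_Rspace (U : set 'rV[R]_n) :
  open U -> measurable (U : set (Rspace R n)).
Proof.
move=> oU.
pose Q := ('rV[rat]_n * 'rV[rat]_n)%type.
pose F (q : Q) : 'rV[R]_n * 'rV[R]_n := (map_mx ratr q.1, map_mx ratr q.2).
rewrite (_ : U = \bigcup_(q in [set q | box (F q) `<=` U]) box (F q)).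
  rewrite bigcup_mkcond; apply: countable_bigcupT_measurable => [|q].
    exact: countableP.
  by case: ifP => _ //; exact: measurable_box.
apply/seteqP; split => [x Ux|x [q /= + xq]]; last exact.
have /nbhs_ballP[e /= e0 eU] : nbhs x U by exact: open_nbhs_nbhs.
have lo i : {q : rat | (x 0 i - e < ratr q < x 0 i)%R}.
  apply/cid; have [|q] := @rat_in_itvoo R (x 0 i - e)%R (x 0%R i); first by lra.
  by rewrite in_itv/=; exists q.
have up i : {q : rat | (x 0 i < ratr q < x 0 i + e)%R}.
  apply/cid; have [|q] := @rat_in_itvoo R (x 0%R i) (x 0 i + e)%R; first by lra.
  by rewrite in_itv/=; exists q.
exists (\row_i projT1 (lo i), \row_i projT1 (up i)).
  move=> z /= zq; apply: eU; split => // i j; rewrite (ord1 i) /ball /=.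
  have := zq j; rewrite !mxE.
  case: (lo j) => p /= /andP[p1 p2]; case: (up j) => p' /= /andP[p3 p4] /andP[z1 z2].
  rewrite ltr_distlC; lra.
move=> i; rewrite /= !mxE.
case: (lo i) => p /= /andP[p1 p2]; case: (up i) => p' /= /andP[p3 p4].
by rewrite p2 ltW.
Qed.

Lemma continuous_measurable_Rspace (D : set 'rV[R]_n) (g : 'rV[R]_n -> R) :
  continuous g -> measurable_fun (D : set (Rspace R n)) (g : Rspace R n -> R).
Proof.
move=> cg; apply: (@measurable_funS _ _ _ _ setT) => //.
move=> mD; apply: (measurability _ (RGenOInfty.measurableE R)) => //.
move=> _ [_ [c ->] <-]; rewrite setTI; apply: open_measurable_Rspace.
by move: cg => /continuousP; apply; exact: interval_open.
Qed.

Lemma esumZl_countable (T : pointedType) (S : set T) (c : R) (a : T -> \bar R) :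
  countable S -> (forall t, 0 <= a t) -> (0 <= c)%R ->
  \esum_(s in S) (c%:E * a s) = c%:E * \esum_(s in S) a s.
Proof.
move=> /countable_enum[e [P [einj ->]]] a0 c0.
rewrite !esum_set_image//; last by move=> *; rewrite mule_ge0.
by rewrite nneseriesZl.
Qed.

(** The preimage of a box is a box whose volume is divided by l^n. *)
Lemma lebesgue_outer_affine_le (l : R) (y : 'rV[R]_n) (A : set 'rV[R]_n) :
  (0 < l)%R ->
  (l ^+ n)%:E * lebesgue_outer ((fun x => l *: x + y)%R @^-1` A) <= lebesgue_outer A.
Proof.
move=> l0; apply: le_ereal_inf_tmp => _ [S [cS AS] <-].
pose F (ab : 'rV[R]_n * 'rV[R]_n) := (l^-1 *: (ab.1 - y), l^-1 *: (ab.2 - y))%R.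
have volF ab : box_volume ab = (l ^+ n)%:E * box_volume (F ab).
  rewrite /box_volume -EFinM; congr EFin.
  rewrite -[n in (_ ^+ n)%R]card_ord -prodr_const -big_split/=.
  apply: eq_bigr => i _; rewrite !mxE -mulrBr opprB addrA subrK.
  rewrite maxr_pMr ?(ltW l0)// mulr0 mulrA divff ?mul1r//; lra.
under eq_esum do rewrite volF.
rewrite esumZl_countable//; [|by move=> *; exact: box_volume_ge0|by rewrite exprn_ge0// ltW].
rewrite lee_pmul2l// ?lte_fin ?exprn_gt0//.
apply: lebesgue_outer_le_esum => // x /AS[ab Sab xab]; exists ab => // i.
have := xab i; rewrite /F !mxE/= => /andP[xa xb].
by rewrite ltr_pdivrMl// ltrBlDr xa/= ler_pdivlMl// lerBrDr.
Qed.

Lemma affineK (l : R) (y : 'rV[R]_n) : l != 0%R ->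
  cancel (fun x => l *: x + y)%R (fun x => l^-1 *: x + (- (l^-1 *: y)))%R.
Proof. by move=> l0 x; rewrite scalerDr scalerA mulVf// scale1r addrK. Qed.

Lemma affineVK (l : R) (y : 'rV[R]_n) : l != 0%R ->
  cancel (fun x => l^-1 *: x + (- (l^-1 *: y)))%R (fun x => l *: x + y)%R.
Proof.
by move=> l0 x; rewrite scalerDr scalerN !scalerA divff// !scale1r subrK.
Qed.

(** The converse inequality is the previous lemma for the inverse map. *)
Lemma lebesgue_outer_affine (l : R) (y : 'rV[R]_n) (A : set 'rV[R]_n) :
  (0 < l)%R ->
  (l ^+ n)%:E * lebesgue_outer ((fun x => l *: x + y)%R @^-1` A) = lebesgue_outer A.
Proof.
move=> l0; apply/eqP; rewrite eq_le lebesgue_outer_affine_le//=.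
have li0 : (0 < l^-1)%R by rewrite invr_gt0.
have := lebesgue_outer_affine_le (- (l^-1 *: y))%R
  ((fun x => l *: x + y)%R @^-1` A) li0.
rewrite -comp_preimage /comp/=.
rewrite (_ : _ @^-1` A = A); last first.
  by apply/seteqP; split => x /=; rewrite (affineVK y (lt0r_neq0 l0)).
have ln0 : 0 <= (l ^+ n)%:E by rewrite lee_fin exprn_ge0// ltW.
move=> /(lee_wpmul2l ln0).
by rewrite muleA -EFinM -exprMn divff ?lt0r_neq0// expr1n mul1e.
Qed.

(** The outer measure of a preimage is a fixed multiple of the outer
measure, so Caratheodory's splitting condition is transported. *)
Lemma measurable_affine (l : R) (y : 'rV[R]_n) : (0 < l)%R ->
  measurable_fun setT ((fun x => l *: x + y)%R : Rspace R n -> Rspace R n).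
Proof.
move=> l0 _ A mA; rewrite setTI.
pose T := (fun x : 'rV[R]_n => l *: x + y)%R.
suff : (@lebesgue_outer R n).-caratheodory (T @^-1` A) by [].
move=> X.
have ln : (0 < l ^+ n)%R by rewrite exprn_gt0.
pose Y := (fun x => l^-1 *: x + (- (l^-1 *: y)))%R @^-1` X.
have XY : X = T @^-1` Y.
  by apply/seteqP; split => x; rewrite /Y /T /= (affineK y (lt0r_neq0 l0)).
have inj (a b : \bar R) : (l ^+ n)%:E * a = (l ^+ n)%:E * b -> a = b.
  move=> /(congr1 (fun z => ((l ^+ n)^-1)%:E * z)).
  by rewrite !muleA -!EFinM mulVf ?lt0r_neq0// !mul1e.
apply: inj; rewrite ge0_muleDr ?lebesgue_outer_ge0//.
rewrite XY preimage_setC -!preimage_setI.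
by rewrite !lebesgue_outer_affine//; exact: mA.
Qed.

(** The exact factor is l^-n; for a dilation factor l >= 1 it can be
dropped. *)
Lemma ge0_integral_affine_le (l : R) (y : 'rV[R]_n) (g : Rspace R n -> \bar R) :
  (1 <= l)%R -> (forall x, 0 <= g x) ->
  measurable_fun setT g ->
  \int[lebesgue]_(x in setT) (g \o ((fun x => l *: x + y)%R : Rspace R n -> Rspace R n)) x <=
  \int[lebesgue]_x g x.
Proof.
move=> l1 g0 mg.
have l0 : (0 < l)%R by apply: lt_le_trans l1.
have mT := measurable_affine y l0.
rewrite -[X in integral _ X](preimage_setT (fun x : 'rV[R]_n => l *: x + y)%R).
rewrite -(ge0_integral_pushforward mT)//.
pose m1 : {measure set (Rspace R n) -> \bar R} :=
  measure_function_pushforward__canonical__measure_function_Measure lebesgue mT.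
apply: (@ge0_le_measure_integral _ _ _ m1 lebesgue) => // S mS.
rewrite /m1 /= /pushforward /lebesgue.
rewrite -[leRHS](lebesgue_outer_affine y _ l0).
rewrite lee_pemull ?lebesgue_outer_ge0//.
by rewrite lee_fin exprn_ege1.
Qed.

End measurable_sets_of_Rspace.

Section cube_volume.
Context {R : realType}.
Local Open Scope ereal_scope.

(** A discrete Fubini argument.  If the weighted boxes cover each point of the cube
with total weight at least c, then integrating over the last coordinate shows
that the weights multiplied by the lengths of the last sides cover the cube of
one dimension less with total weight at least c s.  Arbitrary real weights
are what makes the induction on the dimension go through. *)
Lemma cube_weighted_cover (s : R) (n : nat) (c : R) (w : nat -> R)
    (a b : nat -> nat -> R) : (0 < s)%R -> (0 <= c)%R -> (forall k, 0 <= w k)%R ->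
  (forall x : nat -> R, (forall i, (i < n)%N -> 0 < x i <= s)%R ->
     c%:E <= \sum_(k <oo) (w k * \prod_(i < n) (a k i < x i <= b k i)%R%:R)%:E) ->
  (c * s ^+ n)%:E <=
    \sum_(k <oo) (w k * \prod_(i < n) Num.max 0 (b k i - a k i))%:E.
Proof.
move=> s0; elim: n c w => [|n IH] c w c0 w0 cov.
  have := cov (fun=> 0%R) (fun i (h : (i < 0)%N) => match notF h with end).
  by rewrite expr0 mulr1; under eq_eseriesr do rewrite big_ord0;
    under [X in _ -> _ <= X]eq_eseriesr do rewrite big_ord0.
rewrite exprS mulrA.
have E k : (w k * \prod_(i < n.+1) Num.max 0 (b k i - a k i) =
    w k * Num.max 0 (b k n - a k n) * \prod_(i < n) Num.max 0 (b k i - a k i))%R.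
  by rewrite big_ord_recr/= mulrCA mulrC.
under eq_eseriesr do rewrite E.
apply: (IH (c * s)%R (fun k => w k * Num.max 0 (b k n - a k n))%R).
- by rewrite mulr_ge0// ltW.
- by move=> k; rewrite mulr_ge0// le_max lexx.
move=> x xs.
pose v k := (w k * \prod_(i < n) (a k i < x i <= b k i)%R%:R)%R.
have v0 k : (0 <= v k)%R by rewrite mulr_ge0// prodr_ge0.
pose I : set (measurableTypeR R) := `]0%R, s]%classic.
have mI : measurable I by exact: measurable_itv.
pose J k : set (measurableTypeR R) := `]a k n, b k n]%classic.
have mJ k : measurable (J k) by exact: measurable_itv.
have -> : (c * s)%:E = \int[lebesgue_measure]_(z in I) (cst c%:E z).
  by rewrite integral_cst//= lebesgue_measure_itv/= lte_fin s0 sube0 -EFinM.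
apply: (@le_trans _ _ (\int[lebesgue_measure]_(z in I)
    \sum_(k <oo) ((v k)%:E * (\1_(J k) z)%:E))).
  apply: ge0_le_integral => //.
  - apply: ge0_emeasurable_sum => [k z _ _|k _].
      by rewrite mule_ge0// lee_fin.
    apply: emeasurable_funM => //; apply/measurable_EFinP.
    exact: (@measurable_funS _ _ _ _ setT).
  move=> z Iz.
  apply: le_trans (cov (fun i => if i == n then z else x i) _) _.
    move=> i; rewrite ltnS leq_eqVlt; case: eqP => [_ _|_ /=]; last exact: xs.
    by move: Iz; rewrite /I /= in_itv.
  apply: lee_nneseries => [k _ _|k _].
    by rewrite lee_fin mulr_ge0// prodr_ge0.
  rewrite big_ord_recr/= eqxx -EFinM lee_fin mulrA; apply: ler_pM => //.
  - by rewrite mulr_ge0// prodr_ge0.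
  - rewrite /v le_eqVlt; apply/orP; left; apply/eqP; congr (_ * _)%R.
    by apply: eq_bigr => i _; rewrite (ltn_eqF (ltn_ord i)).
  - rewrite indicE /J; case: (boolP (_ < z <= _)%R) => // h.
    by rewrite mem_set//= in_itv.
rewrite integral_nneseries//; last 2 first.
- move=> k; apply: emeasurable_funM => //; apply/measurable_EFinP.
  exact: (@measurable_funS _ _ _ _ setT).
- by move=> k z _; rewrite mule_ge0// lee_fin.
apply: lee_nneseries => [k _ _|k _].
  by apply: integral_ge0 => z _; rewrite mule_ge0// lee_fin.
rewrite ge0_integralZl//; last 2 first.
- apply/measurable_EFinP; exact: (@measurable_funS _ _ _ _ setT).
- by rewrite lee_fin.
rewrite integral_indic//.
rewrite [leRHS](_ : _ = (v k)%:E * (Num.max 0 (b k n - a k n))%R%:E); last first.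
  by rewrite -EFinM mulrAC.
apply: lee_wpmul2l; first by rewrite lee_fin.
apply: (@le_trans _ _ (lebesgue_measure (J k))).
  by apply: le_measure; rewrite ?inE//; exact: measurableI.
rewrite /J lebesgue_measure_itv/=; case: ifP => _; last by rewrite lee_fin le_max lexx.
by rewrite -EFinB lee_fin le_max lexx orbT.
Qed.

(** The lower bound is the content: it says that Lebesgue measure is not
trivial.  A countable cover becomes a sequence of boxes with weights 0 or 1, and
translation invariance reduces the claim to a cube with a corner at 0. *)
Lemma lebesgue_outer_cube (n : nat) (y : 'rV[R]_n) (s : R) : (0 < s)%R ->
  lebesgue_outer (box (y, y + const_mx s)%R) = (s ^+ n)%:E.
Proof.
move=> s0; apply/eqP; rewrite eq_le; apply/andP; split.
  apply: le_trans (lebesgue_outer_box_le _) _; rewrite lee_fin /=.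
  rewrite -[n in (_ ^+ n)%R]card_ord -prodr_const.
  apply: ler_prod => i _; rewrite le_max lexx/= !mxE ge_max (ltW s0)/=; lra.
rewrite -(lebesgue_outer_affine y _ ltr01) expr1n mul1e.
apply: le_ereal_inf_tmp => _ [S [/countable_enum[e [P [einj ->]]] cov] <-].
rewrite esum_set_image//; last by move=> *; exact: box_volume_ge0.
rewrite eseries_mkcond.
(* Coordinates indexed by nat, with default value 0 from n on; only the first n
   of them are read. *)
pose co (v : 'rV[R]_n) (i : nat) : R := if insub i is Some j then v 0%R j else 0%R.
have coE v (i : 'I_n) : co v i = v 0%R i by rewrite /co valK.
pose w k : R := (k \in P)%:R.
have w0 k : (0 <= w k)%R by exact: ler0n.
rewrite -[X in X%:E]mul1r.
apply: (@le_trans _ _ (\sum_(k <oo) (w k * \prod_(i < n)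
    Num.max 0 (co (e k).2 i - co (e k).1 i))%:E)); last first.
  apply: lee_nneseries => [k _ _|k _].
    by rewrite lee_fin mulr_ge0 // prodr_ge0// => i _; rewrite le_max lexx.
  rewrite /w; case: (k \in P); last by rewrite mul0r.
  by rewrite mul1r /box_volume lee_fin ler_prod// => i _; rewrite !coE le_max !lexx.
apply: (@cube_weighted_cover s n 1 w (fun k => co (e k).1) (fun k => co (e k).2)) => //.
move=> x xs.
have : ((fun z => 1 *: z + y)%R @^-1` box (y, y + const_mx s)%R)
    (\row_i x i)%R.
  by move=> i; rewrite /= !mxE mul1r ltrDr addrC lerD2l xs.
move=> /cov[_ [k Pk <-] xk].
apply: (@le_trans _ _ (\sum_(0 <= j < k.+1) (w j * \prod_(i < n)
    (co (e j).1 i < x i <= co (e j).2 i)%R%:R)%:E)); last first.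
  by apply: nneseries_lim_ge => j _ _; rewrite lee_fin mulr_ge0 // prodr_ge0.
rewrite big_nat_recr//= lee_paddl//.
  by apply: sume_ge0 => j _; rewrite lee_fin mulr_ge0 // prodr_ge0.
rewrite /w mem_set// mul1r lee_fin big1// => i _; rewrite !coE.
by have := xk i; rewrite mxE => ->.
Qed.

End cube_volume.

(** * A smooth step function *)

Section flat_functions.
Context {R : realType}.
Implicit Types (p q : {poly R}) (x y : R).

(** The functions p(1/x) exp(-1/x), extended by 0, form a class that is closed
under differentiation; this is what makes exp(-1/x) smooth at 0. *)
Definition flat p x : R := if 0 < x then p.[x^-1] * expR (- x^-1) else 0.

(** The n-th term of the exponential series is at most its sum. *)
Lemma expr_expRN_le y k : 0 <= y -> y ^+ k * expR (- y) <= k`!%:R.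
Proof.
move=> y0; rewrite expRN ler_pdivrMr ?expR_gt0//.
case: k => [|k]; first by rewrite expr0 fact0 mul1r -expR0 ler_expR.
rewrite mulrC -ler_pdivrMr ?ltr0n ?fact_gt0//.
by apply: le_trans (expR_ge1Dxn k y0); rewrite lerDr.
Qed.

Lemma flat_bounded p : exists2 B : R, 0 <= B & forall x, `|flat p x| <= B.
Proof.
exists (\sum_(i < size p) `|p`_i| * i`!%:R).
  by apply: sumr_ge0 => i _; rewrite mulr_ge0.
move=> x; rewrite /flat; case: ifP => [x0|_]; last first.
  by rewrite normr0; apply: sumr_ge0 => i _; rewrite mulr_ge0.
rewrite normrM [`|expR _|]ger0_norm ?expR_ge0// horner_coef.
apply: (@le_trans _ _ ((\sum_(i < size p) `|p`_i * x^-1 ^+ i|) * expR (- x^-1))).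
  by rewrite ler_wpM2r ?expR_ge0// ler_norm_sum.
rewrite mulr_suml; apply: ler_sum => i _.
have xi : 0 <= x^-1 by rewrite invr_ge0 ltW.
rewrite normrM [`|x^-1 ^+ i|]ger0_norm ?exprn_ge0// -mulrA ler_wpM2l//.
exact: expr_expRN_le.
Qed.

Lemma flat_Mx p x : flat p x = x * flat ('X * p) x.
Proof.
rewrite /flat; case: ifP => [x0|]; last by rewrite mulr0.
by rewrite hornerM hornerX !mulrA divff ?mul1r// gt_eqF.
Qed.

(** At 0 the difference quotient of [flat p] is [flat ('X * p)], which tends to 0
because it is itself of the form x times a bounded function. *)
Lemma is_derive_flat p x :
  is_derive x 1 (flat p) (flat ('X^2 * (p - deriv p)) x).
Proof.
have [x0|x0|->] := ltgtP x 0.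
- apply: (@near_eq_is_derive _ _ _ (cst 0)); last first.
    by rewrite /flat ltNge (ltW x0); exact: is_derive_cst.
  near=> z; rewrite /flat; suff -> : (0 < z) = false by [].
  by apply/negbTE; rewrite -leNgt ltW//; near: z; exact: lt_nbhsl.
- apply: (@near_eq_is_derive _ _ _ (fun z : R => p.[z^-1] * expR (- z^-1) : R)).
    by near=> z; rewrite /flat ifT//; near: z; exact: lt_nbhsr.
  have xn : x != 0 by rewrite gt_eqF.
  have dV : is_derive x 1 (fun z : R => z^-1) (- x ^- 2 *: 1) by exact: is_deriveV.
  have dp := @is_derive1_comp _ (horner p) (fun z : R => z^-1) x _ _ (is_derive_poly p x^-1) dV.
  have dN := @is_derive1_comp _ expR (fun z : R => - z^-1) x _ _ (is_derive_expR _) (is_deriveN dV).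
  refine (is_derive_eq (is_deriveM dp dN) _).
  rewrite /flat x0 hornerM hornerXn hornerD hornerN.
  rewrite /GRing.scale/= mulr1 exprVn; ring.
- have flat0 q : flat q 0 = 0 by rewrite /flat ltxx.
  have [B B0 leB] := flat_bounded ('X * ('X * p)).
  suff cv : (fun h => h^-1 *: ((flat p \o shift 0) (h *: 1) - flat p 0)) @ 0^' --> (0 : R).
    apply: DeriveDef; last by rewrite flat0; exact/cvg_lim.
    by apply/cvg_ex; exists 0.
  apply/cvgrPdist_lt => e e0; near=> h.
  have hn0 : h != 0 by near: h; exact: nbhs_dnbhs_neq.
  rewrite sub0r normrN flat0 subr0 /= addr0 /GRing.scale/= mulr1.
  rewrite flat_Mx mulrA mulVf// mul1r flat_Mx normrM.
  apply: (@le_lt_trans _ _ (`|h| * (B + 1))).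
    by rewrite ler_wpM2l// (le_trans (leB _))// lerDl.
  rewrite -ltr_pdivlMr; last by rewrite ltr_wpDl.
  near: h; apply: dnbhs0_lt.
  by rewrite divr_gt0// ltr_wpDl.
Unshelve. all: by end_near. Qed.

Lemma flat1_ge0 x : 0 <= flat 1 x.
Proof. by rewrite /flat; case: ifP => // _; rewrite hornerE ?mul1r expR_ge0. Qed.

Lemma flat1_nondecreasing x y : x <= y -> flat 1 x <= flat 1 y.
Proof.
move=> xy; have [x0|x0] := leP x 0.
  by rewrite {1}/flat ltNge x0 /= flat1_ge0.
have y0 : 0 < y by exact: lt_le_trans xy.
by rewrite /flat x0 y0 !hornerE ?mul1r ler_expR lerN2 lef_pV2.
Qed.

Lemma flat_le0 p x : x <= 0 -> flat p x = 0.
Proof. by rewrite /flat ltNge => ->. Qed.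

End flat_functions.

Section smooth_step.
Context {R : realType}.
Implicit Types s t : R.

(** With e = [flat 1] and c = e(1/8) this is 1 - e(c - e(s - 1/8)) / e(c).  Up to
s = 1/8 the inner e vanishes and the quotient is 1; from s = 1/4 on, e(s - 1/8)
is at least c and the quotient is 0.  Nesting avoids quotients of functions, so that
smoothness only involves sums, products and compositions. *)
Definition step s : R :=
  1 - (flat 1 (flat 1 8^-1))^-1 * flat 1 (flat 1 8^-1 - flat 1 (s - 8^-1)).

Definition dstep s : R := (flat 1 (flat 1 8^-1))^-1 *
  (flat 'X^2 (flat 1 8^-1 - flat 1 (s - 8^-1)) * flat 'X^2 (s - 8^-1)).

Lemma flat1_gt0 s : 0 < s -> 0 < flat 1 s.
Proof. by move=> s0; rewrite /flat s0 hornerE ?mul1r expR_gt0. Qed.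

Lemma step_scale_gt0 : 0 < flat 1 (flat 1 8^-1) :> R.
Proof. by rewrite !flat1_gt0// invr_gt0. Qed.

Lemma step0 s : s <= 8^-1 -> step s = 0.
Proof.
move=> s8; rewrite /step [flat 1 (s - _)]flat_le0 ?subr0; last by rewrite subr_le0.
by rewrite mulVf ?subrr// gt_eqF// step_scale_gt0.
Qed.

Lemma step1 s : 4^-1 <= s -> step s = 1.
Proof.
move=> s4; rewrite /step [flat 1 (_ - flat _ _)]flat_le0 ?mulr0 ?subr0//.
rewrite subr_le0 flat1_nondecreasing// lerBrDr.
by apply: le_trans s4; lra.
Qed.

Lemma step_ge0 s : 0 <= step s.
Proof.
rewrite /step subr_ge0 ler_pdivrMl ?step_scale_gt0// mulr1.
by apply: flat1_nondecreasing; rewrite gerBl flat1_ge0.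
Qed.

(** The derivative vanishes at the end points 1/8 and 1/4 as well, so the shells on
which truncations have a nonzero gradient are open, hence disjoint for
consecutive powers of 2. *)
Lemma dstep_eq0 s : s <= 8^-1 \/ 4^-1 <= s -> dstep s = 0.
Proof.
rewrite /dstep => -[s8|s4].
  by rewrite [flat 'X^2 (s - _)]flat_le0 ?subr_le0// !mulr0.
rewrite [flat 'X^2 (_ - flat _ _)]flat_le0 ?mul0r ?mulr0//.
rewrite subr_le0 flat1_nondecreasing// lerBrDr.
by apply: le_trans s4; lra.
Qed.

Lemma dstep_bounded : exists2 L : R, 0 < L & forall s, `|dstep s| <= L.
Proof.
have [B B0 leB] := @flat_bounded R 'X^2.
exists ((flat 1 (flat 1 8^-1))^-1 * (B * B) + 1).
  by rewrite ltr_wpDl// !mulr_ge0// invr_ge0 ltW// step_scale_gt0.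
move=> s; rewrite /dstep normrM ger0_norm; last by rewrite invr_ge0 ltW// step_scale_gt0.
rewrite ler_wpDr// ler_wpM2l//; first by rewrite invr_ge0 ltW// step_scale_gt0.
by rewrite normrM ler_pM.
Qed.

Lemma is_derive_flat1 s : is_derive s 1 (flat 1) (flat 'X^2 s).
Proof.
have := is_derive_flat 1 s; rewrite (_ : deriv 1 = 0) ?subr0 ?mulr1//.
by rewrite -[1]/(1%:P) derivC.
Qed.

Lemma is_derive_step s : is_derive s 1 step (dstep s).
Proof.
have d1 := @is_derive1_comp _ (flat 1) (fun s => s - 8^-1) s _ _
  (is_derive_flat1 _) (is_deriveB (is_derive_id _ _) (is_derive_cst _ _ _)).
have d2 := @is_derive1_comp _ (flat 1) (fun s => flat 1 8^-1 - flat 1 (s - 8^-1)) s _ _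
  (is_derive_flat1 _) (is_deriveB (is_derive_cst _ _ _) d1).
refine (is_derive_eq (is_deriveB (is_derive_cst _ _ _)
  (is_deriveZ (flat 1 (flat 1 8^-1))^-1 d2)) _).
rewrite /dstep /GRing.scale/=; ring.
Qed.

End smooth_step.

(** * Calculus of smooth functions *)

Section directional_derivatives.
Context {R : realType} {n : nat}.
Implicit Types (f g : 'rV[R]_n -> R) (x v y : 'rV[R]_n).

(** Reduces directional derivatives to derivatives in one variable. *)
Lemma is_derive_line f x v df :
  is_derive x v f df <-> is_derive (0 : R) 1 (fun t => f (t *: v + x)) df.
Proof.
have E : (fun h : R => h^-1 *: ((f \o shift x) (h *: v) - f x)) =
    (fun h : R => h^-1 *: (((fun t => f (t *: v + x)) \o shift 0) (h *: 1) -
       f (0 *: v + x))).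
  by apply/funext => h /=; rewrite addr0 scale0r add0r /GRing.scale/= mulr1.
by split=> -[d1 d2]; apply: DeriveDef; move: d1 d2;
  rewrite /derivable /derive E.
Qed.

Lemma is_derive_comp1 (h : R -> R) f x v dh df :
  is_derive (f x) 1 h dh -> is_derive x v f df ->
  is_derive x v (h \o f) (dh * df).
Proof.
move=> hdh /is_derive_line fdf; apply/is_derive_line.
apply: (@is_derive1_comp _ h (fun t => f (t *: v + x)) 0 dh df) => //.
by rewrite scale0r add0r.
Qed.

Lemma is_derive_affine f x y v l df :
  is_derive (l *: x + y) v f df ->
  is_derive x v (fun z => f (l *: z + y)) (df * l).
Proof.
move=> /is_derive_line fdf; apply/is_derive_line.
have dl : is_derive (0 : R) 1 (fun t : R => l * t) l.
  refine (is_derive_eq (is_deriveZ l (is_derive_id _ _)) _).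
  by rewrite /GRing.scale/= mulr1.
have := @is_derive1_comp _ (fun t => f (t *: v + (l *: x + y))) (fun t => l * t) 0 df l.
rewrite mulr0 => /(_ fdf dl).
rewrite (_ : _ \o _ = (fun t => f (l *: (t *: v + x) + y)))//.
by apply/funext => t /=; rewrite scalerDr scalerA addrA.
Qed.

(** Finite order of smoothness, peeling off the first partial derivative.  The
definition of [smooth] peels off the last one; the recursive form is the one
that the Leibniz and chain rules can be proved for by induction. *)
Fixpoint Ck k f : Prop := continuous f /\
  if k is k'.+1 then
    forall i, (forall x, derivable f x (delta_mx 0 i)) /\ Ck k' (partial i f)
  else True.

Lemma CkS k f : Ck k.+1 f -> Ck k f.
Proof.
elim: k f => [|k IH] f [cf H]; first by split.
by split => // i; have [? ?] := H i; split => //; exact: IH.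
Qed.

Lemma smoothP f : smooth f <-> forall k, Ck k f.
Proof.
split=> [sf k|].
  elim: k f sf => [|k IH] f sf; first by split => //; exact: (sf [::]).1.
  split; first exact: (sf [::]).1.
  move=> i; split => [x|]; first exact: (sf [::]).2.
  by apply: IH => s; have := sf (rcons s i); rewrite foldr_rcons.
move=> Hf s; elim/last_ind: s f Hf => [|s i IH] f Hf.
  have [cf H] := Hf 1; split => // i x; exact: (H i).1.
rewrite foldr_rcons; apply: IH => k; have [_ H] := Hf k.+1; exact: (H i).2.
Qed.

Lemma Ck_cst k (c : R) : Ck k (fun=> c).
Proof.
elim: k c => [|k IH] c; split => //; try by move=> x; exact: cst_continuous.
move=> i; split => [x|]; first exact: derivable_cst.
rewrite (_ : partial _ _ = (fun=> 0))//; apply/funext => x.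
by rewrite /partial derive_cst.
Qed.

Lemma CkD k f g : Ck k f -> Ck k g -> Ck k (f \+ g).
Proof.
elim: k f g => [|k IH] f g [cf df] [cg dg]; split => //.
- by move=> x; exact: (continuousD (cf x) (cg x)).
- by move=> x; exact: (continuousD (cf x) (cg x)).
move=> i; have [d1 c1] := df i; have [d2 c2] := dg i.
split => [x|]; first exact: derivableD.
rewrite (_ : partial _ _ = partial i f \+ partial i g); first exact: IH.
by apply/funext => x; rewrite /partial deriveD.
Qed.

Lemma CkM k f g : Ck k f -> Ck k g -> Ck k (f \* g).
Proof.
elim: k f g => [|k IH] f g Hf Hg; split => //.
- by move=> x; exact: (continuousM (Hf.1 x) (Hg.1 x)).
- by move=> x; exact: (continuousM (Hf.1 x) (Hg.1 x)).
move=> i; have [d1 c1] := Hf.2 i; have [d2 c2] := Hg.2 i.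
split => [x|]; first exact: derivableM.
rewrite (_ : partial _ _ = (f \* partial i g) \+ (g \* partial i f)).
  by apply: CkD; apply: IH => //; exact: CkS.
by apply/funext => x; rewrite /partial deriveM.
Qed.

Lemma affine_continuous (l : R) y : continuous (fun x : 'rV[R]_n => l *: x + y).
Proof.
move=> x; have h1 := @scaler_continuous _ 'rV[R]_n l x.
have h2 : {for x, continuous (fun _ : 'rV[R]_n => y)} by exact: cst_continuous.
exact: (continuousD h1 h2).
Qed.

Lemma Ck_affine k f l y : Ck k f -> Ck k (fun x => f (l *: x + y)).
Proof.
elim: k f => [|k IH] f [cf df]; split => //.
- by move=> x; apply: continuous_comp; [exact: affine_continuous|exact: cf].
- by move=> x; apply: continuous_comp; [exact: affine_continuous|exact: cf].
move=> i; have [d1 c1] := df i.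
have H x := is_derive_affine (derivableP (d1 (l *: x + y))).
split => [x|]; first exact: (@ex_derive _ _ _ _ _ _ _ (H x)).
rewrite (_ : partial _ _ = (fun=> l) \* (fun x => partial i f (l *: x + y))).
  by apply: CkM; [exact: Ck_cst|exact: IH].
by apply/funext => x; rewrite /partial /= mulrC; have [_ ->] := H x.
Qed.

(** Stated for all p at once: by the chain rule, the first derivative involves
[flat] of another polynomial. *)
Lemma Ck_comp_flat k (p : {poly R}) f : Ck k f -> Ck k (flat p \o f).
Proof.
have cp q : continuous (flat q).
  move=> s; apply: differentiable_continuous; apply/derivable1_diffP.
  exact: (@ex_derive _ _ _ _ _ _ _ (is_derive_flat q s)).
elim: k p f => [|k IH] p f Hf; split => //.
- by move=> x; apply: continuous_comp; [exact: Hf.1|exact: cp].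
- by move=> x; apply: continuous_comp; [exact: Hf.1|exact: cp].
move=> i; have [d1 c1] := Hf.2 i.
have H x := is_derive_comp1 (is_derive_flat p (f x)) (derivableP (d1 x)).
split => [x|]; first exact: (@ex_derive _ _ _ _ _ _ _ (H x)).
rewrite (_ : partial _ _ = (flat ('X^2 * (p - deriv p)) \o f) \* partial i f).
  by apply: CkM => //; apply: IH; exact: CkS.
by apply/funext => x; rewrite /partial /=; have [_ ->] := H x.
Qed.

Lemma smooth_cst (c : R) : smooth (fun _ : 'rV[R]_n => c).
Proof. by apply/smoothP => k; exact: Ck_cst. Qed.

Lemma smoothD f g : smooth f -> smooth g -> smooth (f \+ g).
Proof. by move=> /smoothP sf /smoothP sg; apply/smoothP => k; exact: CkD. Qed.

Lemma smoothM f g : smooth f -> smooth g -> smooth (f \* g).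
Proof. by move=> /smoothP sf /smoothP sg; apply/smoothP => k; exact: CkM. Qed.

Lemma smooth_affine f l y : smooth f -> smooth (fun x => f (l *: x + y)).
Proof. by move=> /smoothP sf; apply/smoothP => k; exact: Ck_affine. Qed.

Lemma smooth_comp_flat p f : smooth f -> smooth (flat p \o f).
Proof. by move=> /smoothP sf; apply/smoothP => k; exact: Ck_comp_flat. Qed.

Lemma smooth_comp_step f : smooth f -> smooth (step \o f).
Proof.
move=> sf; rewrite (_ : step \o f = (fun=> 1) \+ ((fun=> - (flat 1 (flat 1 8^-1))^-1) \*
   (flat 1 \o ((fun=> flat 1 8^-1) \+ ((fun=> -1) \*
     (flat 1 \o (f \+ (fun=> - 8^-1)))))))).
  exact: smoothD (smooth_cst 1) (smoothM (smooth_cst _) (smooth_comp_flat 1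
    (smoothD (smooth_cst _) (smoothM (smooth_cst _) (smooth_comp_flat 1
      (smoothD sf (smooth_cst _))))))).
by apply/funext => x; rewrite /step /= mulN1r mulNr.
Qed.

Lemma smooth_continuous f : smooth f -> continuous f.
Proof. by move=> sf; exact: (sf [::]).1. Qed.

Lemma smooth_derivable f i x : smooth f -> derivable f x (delta_mx 0 i).
Proof. by move=> sf; exact: (sf [::]).2. Qed.

Lemma smooth_partial_continuous f i : smooth f -> continuous (partial i f).
Proof. by move=> sf; exact: (sf [:: i]).1. Qed.

Lemma gradient_comp (h : R -> R) (dh : R) f x : smooth f ->
  is_derive (f x) 1 h dh -> gradient (h \o f) x = dh *: gradient f x.
Proof.
move=> sf hdh; apply/rowP => i; rewrite !mxE /partial.
by have [_ ->] := is_derive_comp1 hdh (derivableP (@smooth_derivable f i x sf)).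
Qed.

Lemma gradientD f g x : smooth f -> smooth g ->
  gradient (f \+ g) x = gradient f x + gradient g x.
Proof.
move=> sf sg; apply/rowP => i; rewrite !mxE /partial.
by apply: deriveD; exact: smooth_derivable.
Qed.

Lemma gradientZ (c : R) f x : smooth f ->
  gradient ((fun=> c) \* f) x = c *: gradient f x.
Proof.
move=> sf; apply/rowP => i; rewrite !mxE /partial.
rewrite (@deriveM _ _ (cst c) f)//; first by rewrite derive_cst scaler0 addr0.
exact: smooth_derivable.
Qed.

Lemma gradient_affine f l y x : smooth f ->
  gradient (fun z => f (l *: z + y)) x = l *: gradient f (l *: x + y).
Proof.
move=> sf; apply/rowP => i; rewrite !mxE /partial mulrC.
by have [_ ->] := is_derive_affine (derivableP (@smooth_derivable f i (l *: x + y) sf)).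
Qed.

End directional_derivatives.

(** * The Euclidean norm *)

Section euclidean_norm.
Context {R : realType} {n : nat}.
Implicit Types (x y : 'rV[R]_n).

Lemma enorm_ge0 x : 0 <= enorm x.
Proof. exact: sqrtr_ge0. Qed.

Lemma sqr_enorm x : enorm x ^+ 2 = \sum_(i < n) x 0 i ^+ 2.
Proof. by rewrite sqr_sqrtr// sumr_ge0// => i _; exact: sqr_ge0. Qed.

Lemma enorm0 : enorm (0 : 'rV[R]_n) = 0.
Proof.
by rewrite /enorm big1 ?sqrtr0// => i _; rewrite mxE expr0n.
Qed.

Lemma enormZ (c : R) x : enorm (c *: x) = `|c| * enorm x.
Proof.
rewrite /enorm (eq_bigr (fun i => c ^+ 2 * x 0 i ^+ 2)); last first.
  by move=> i _; rewrite mxE exprMn.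
by rewrite -mulr_sumr sqrtrM ?sqr_ge0// sqrtr_sqr.
Qed.

Lemma ler_coord_enorm x i : `|x 0 i| <= enorm x.
Proof.
rewrite -(@ler_pXn2r _ 2)// ?nnegrE ?enorm_ge0// sqr_enorm real_normK ?num_real//.
by rewrite (bigD1 i)//= lerDl sumr_ge0// => j _; exact: sqr_ge0.
Qed.

Lemma enorm_eq0_coord x i : enorm x = 0 -> x 0 i = 0.
Proof.
by move=> x0; apply/eqP; rewrite -normr_le0 -[leRHS]x0 ler_coord_enorm.
Qed.

(** Expand the sum of the squares of |y| x_i - |x| y_i. *)
Lemma cauchy_schwarz x y : \sum_(i < n) x 0 i * y 0 i <= enorm x * enorm y.
Proof.
have [x0|x0] := eqVneq (enorm x) 0.
  by rewrite x0 mul0r big1// => i _; rewrite (enorm_eq0_coord i x0) mul0r.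
have [y0|y0] := eqVneq (enorm y) 0.
  by rewrite y0 mulr0 big1// => i _; rewrite (enorm_eq0_coord i y0) mulr0.
have xgt0 : 0 < enorm x by rewrite lt0r x0 enorm_ge0.
have ygt0 : 0 < enorm y by rewrite lt0r y0 enorm_ge0.
have : 0 <= \sum_(i < n) (enorm y * x 0 i - enorm x * y 0 i) ^+ 2.
  by apply: sumr_ge0 => i _; exact: sqr_ge0.
rewrite (eq_bigr (fun i => enorm y ^+ 2 * x 0 i ^+ 2 + enorm x ^+ 2 * y 0 i ^+ 2 -
    2 * enorm x * enorm y * (x 0 i * y 0 i))); last by move=> i _; ring.
rewrite sumrB big_split/= -!mulr_sumr -!sqr_enorm => h.
have : 0 <= (2 * enorm x * enorm y) * (enorm x * enorm y - \sum_(i < n) x 0 i * y 0 i).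
  apply: le_trans h _; rewrite le_eqVlt; apply/orP; left; apply/eqP; ring.
by rewrite pmulr_rge0 ?subr_ge0// !mulr_gt0.
Qed.

Lemma ler_enormD x y : enorm (x + y) <= enorm x + enorm y.
Proof.
rewrite -(@ler_pXn2r _ 2)// ?nnegrE ?addr_ge0 ?enorm_ge0//.
rewrite sqr_enorm (eq_bigr (fun i => x 0 i ^+ 2 + y 0 i ^+ 2 + 2 * (x 0 i * y 0 i))).
  rewrite !big_split/= -!sqr_enorm -mulr_sumr.
  have := cauchy_schwarz x y; set S := \sum_(_ < _) _ => h.
  have -> : (enorm x + enorm y) ^+ 2 =
    enorm x ^+ 2 + enorm y ^+ 2 + 2 * (enorm x * enorm y) by ring.
  by rewrite lerD2l ler_wpM2l.
by move=> i _; rewrite mxE; ring.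
Qed.

Lemma ler_enorm_sum (I : Type) (s : seq I) (F : I -> 'rV[R]_n) :
  enorm (\sum_(i <- s) F i) <= \sum_(i <- s) enorm (F i).
Proof.
elim: s => [|a s IH]; first by rewrite !big_nil enorm0.
by rewrite !big_cons (le_trans (ler_enormD _ _))// lerD2l.
Qed.

Lemma ler_norm_enorm x : `|x| <= enorm x.
Proof.
rewrite [leLHS]/Num.norm /= mx_normrE; apply/bigmax_leP; split; first exact: enorm_ge0.
by move=> [i j] _ /=; rewrite (ord1 i) ler_coord_enorm.
Qed.

Lemma enorm_le_coord x (d : R) : 0 <= d -> (forall i, `|x 0 i| <= d) ->
  enorm x <= n%:R * d.
Proof.
move=> d0 xd; have -> : x = \sum_(i < n) x 0 i *: delta_mx 0 i.
  by rewrite {1}[x]row_sum_delta.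
apply: le_trans (ler_enorm_sum _ _) _.
rewrite mulr_natl -[X in d *+ X]card_ord -sumr_const.
apply: ler_sum => i _; rewrite enormZ.
have -> : enorm (delta_mx 0 i : 'rV[R]_n) = 1.
  rewrite /enorm (bigD1 i)//= mxE !eqxx expr1n big1 ?addr0 ?sqrtr1//.
  by move=> j ji; rewrite mxE (negbTE ji) expr0n.
by rewrite mulr1.
Qed.

Lemma continuous_sum (T : topologicalType) (I : Type) (s : seq I) (F : I -> T -> R) :
  (forall i, continuous (F i)) -> continuous (fun z => \sum_(i <- s) F i z).
Proof.
move=> cF; elim: s => [|a s IH] z.
  by under eq_fun do rewrite big_nil; exact: cst_continuous.
under eq_fun do rewrite big_cons.
exact: (continuousD (cF a z) (IH z)).
Qed.

Lemma continuous_enorm (T : topologicalType) (g : T -> 'rV[R]_n) :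
  (forall i, continuous (fun z => g z 0 i)) -> continuous (fun z => enorm (g z)).
Proof.
move=> cg z; apply: (@continuous_comp _ _ _ (fun z => \sum_(i < n) g z 0 i ^+ 2) Num.sqrt);
  last exact: sqrt_continuous.
apply: continuous_sum => i t; under eq_fun do rewrite expr2.
exact: (continuousM (cg i t) (cg i t)).
Qed.

Lemma enorm_continuous : continuous (@enorm R n).
Proof. by apply: (@continuous_enorm _ id) => i x; exact: coord_continuous. Qed.

Lemma open_eball (r : R) : open (eball n r).
Proof.
rewrite (_ : eball n r = @enorm R n @^-1` `]-oo, r[%classic).
  by move: enorm_continuous => /continuousP; apply; exact: interval_open.
by apply/seteqP; split => x /=; rewrite in_itv.
Qed.

Lemma continuous_enorm_gradient (f : 'rV[R]_n -> R) : smooth f ->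
  continuous (fun x => enorm (gradient f x)).
Proof.
move=> sf; apply: continuous_enorm => i.
rewrite (_ : (fun x => _) = partial i f); first exact: smooth_partial_continuous.
by apply/funext => x; rewrite mxE.
Qed.

End euclidean_norm.

(** * Compactly supported smooth functions *)

Section compactly_supported.
Context {R : realType} {n : nat}.
Implicit Types (f g : 'rV[R]_n -> R) (G K : set 'rV[R]_n).

Lemma Cc_intro G K f : smooth f -> compact K -> K `<=` G ->
  (forall x, f x != 0 -> K x) -> Cc_infty G f.
Proof.
move=> sf cK KG fK.
have clK : closed K by apply: compact_closed => //; exact: norm_hausdorff.
have sub : closure [set x | f x != 0] `<=` K.
  by rewrite closureE; apply: smallest_sub => // x /= /fK.
split => //; last exact: subset_trans KG.
by apply: subclosed_compact sub => //; exact: closed_closure.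
Qed.

Lemma Cc_eq0 G f x : Cc_infty G f -> ~ G x -> f x = 0.
Proof.
move=> [_ _ fG] Gx; apply/eqP; apply/negPn/negP => fx.
by apply: Gx; apply: fG; exact: subset_closure.
Qed.

Lemma Cc_smooth G f : Cc_infty G f -> smooth f.
Proof. by case. Qed.

Lemma CcD G f g : Cc_infty G f -> Cc_infty G g -> Cc_infty G (f \+ g).
Proof.
move=> [sf cf fG] [sg cg gG].
apply: (Cc_intro (smoothD sf sg) (compactU cf cg)).
  by rewrite subUset.
move=> x; have [f0|fx _] := eqVneq (f x) 0; last by left; exact: subset_closure.
by rewrite /= f0 add0r => gx; right; exact: subset_closure.
Qed.

Lemma Cc0 G : Cc_infty G (fun=> 0).
Proof.
apply: (@Cc_intro G set0) => //; [exact: smooth_cst|exact: compact0|].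
by move=> x; rewrite eqxx.
Qed.

Lemma Cc_sum G (I : Type) (s : seq I) (F : I -> 'rV[R]_n -> R) :
  (forall i, Cc_infty G (F i)) -> Cc_infty G (fun x => \sum_(i <- s) F i x).
Proof.
move=> HF; elim: s => [|a s IH].
  by under eq_fun do rewrite big_nil; exact: Cc0.
by under eq_fun do rewrite big_cons; exact: CcD.
Qed.

Lemma Cc_zero_preserving G f g : Cc_infty G f -> smooth g ->
  (forall x, f x = 0 -> g x = 0) -> Cc_infty G g.
Proof.
move=> [sf cf fG] sg fg; apply: (Cc_intro sg cf fG) => x gx.
by apply: subset_closure => /=; apply: contra_neq gx => /fg.
Qed.

Lemma CcZ G (c : R) f : Cc_infty G f -> Cc_infty G ((fun=> c) \* f).
Proof.
move=> Gf; apply: (Cc_zero_preserving Gf).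
  by apply: smoothM; [exact: smooth_cst|exact: Cc_smooth Gf].
by move=> x /= ->; rewrite mulr0.
Qed.

Lemma Cc_step G f : Cc_infty G f -> Cc_infty G (step \o f).
Proof.
move=> Gf; apply: (Cc_zero_preserving Gf).
  by apply: smooth_comp_step; exact: Cc_smooth Gf.
by move=> x /= ->; rewrite step0// invr_ge0.
Qed.

(** A point x of the new support satisfies |l x + y| < r, so |x| < (r + |y|) / l,
which is at most r by the bound on y. *)
Lemma Cc_affine (r l : R) (y : 'rV[R]_n) f : 1 < l -> enorm y <= (l - 1) * r ->
  Cc_infty (eball n r) f -> Cc_infty (eball n r) (fun x => f (l *: x + y)).
Proof.
move=> l1 yr [sf cf fG]; have l0 : l != 0 by rewrite gt_eqF//; lra.
pose K := (fun x : 'rV[R]_n => l^-1 *: x + (- (l^-1 *: y))) @` closure [set x | f x != 0].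
apply: (@Cc_intro _ K); first exact: smooth_affine.
- apply: continuous_compact => //; apply: continuous_subspaceT.
  exact: affine_continuous.
- move=> _ [x /fG + <-]; rewrite /eball /= => xr.
  rewrite -scalerBr enormZ ger0_norm ?invr_ge0; last lra.
  rewrite ltr_pdivrMl; last lra.
  apply: le_lt_trans (ler_enormD _ _) _.
  have -> : enorm (- y) = enorm y by rewrite -scaleN1r enormZ normrN1 mul1r.
  lra.
move=> x fx; exists (l *: x + y); first exact: subset_closure.
by rewrite scalerDr scalerA mulVf// scale1r addrK.
Qed.

(** A locally uniform property of pairs of nearby points is uniform over a compact
set. *)
Lemma compact_uniform K (Q : 'rV[R]_n -> 'rV[R]_n -> Prop) : compact K ->
  (forall x, K x -> exists2 e : R, 0 < e &
     forall x' z, ball x e x' -> ball x e z -> Q x' z) ->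
  exists2 d : R, 0 < d & forall x z, K x -> `|x - z| < d -> Q x z.
Proof.
move=> /compact_near_coveringP cK locQ.
have := cK R 0^'+ (fun d x => forall z, `|x - z| < d -> Q x z) _.
case.
  move=> x /locQ[e e0 eQ].
  exists (ball x (e / 2), [set d | d < e / 2]) => /=.
    split; first by apply: nbhsx_ballx; rewrite divr_gt0.
    by apply: nbhs_right_lt; rewrite divr_gt0.
  move=> [x' d] /= [xx' de] z x'z; apply: eQ.
    by apply: le_ball xx'; rewrite ler_pdivrMr// ler_pMr// ler1n.
  rewrite [e]splitr; apply: ball_triangle xx' _.
  by rewrite -ball_normE /=; exact: lt_trans de.
move=> d /= d0 H; exists (d / 2); first by rewrite divr_gt0.
move=> x z Kx xz; apply: (H (d / 2)) xz => //=; last by rewrite divr_gt0.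
rewrite /ball /= sub0r normrN gtr0_norm ?divr_gt0//.
by rewrite ltr_pdivrMr// ltr_pMr// ltr1n.
Qed.

Lemma compact_dist_open K (O : set 'rV[R]_n) : compact K -> open O -> K `<=` O ->
  exists2 d : R, 0 < d & forall x z, K x -> `|x - z| < d -> O z.
Proof.
move=> cK oO KO; apply: compact_uniform cK _ => x /KO Ox.
have /nbhs_ballP[e /= e0 eO] : nbhs x O by exact: open_nbhs_nbhs.
by exists e => // x' z _; exact: eO.
Qed.

Lemma heine K f (e : R) : compact K -> continuous f -> 0 < e ->
  exists2 d : R, 0 < d & forall x z, K x -> `|x - z| < d -> `|f x - f z| < e.
Proof.
move=> cK cf e0.
apply: (@compact_uniform K (fun x z => `|f x - f z| < e)) => // x _.
have /cvgrPdist_lt/(_ (e / 2)) := cf x.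
rewrite divr_gt0// => /(_ isT)/nbhs_ballP[r /= r0 rf].
exists r => // x' z /rf xx' /rf xz.
have -> : f x' - f z = (f x - f z) - (f x - f x') by ring.
by apply: le_lt_trans (ler_normB _ _) _; rewrite [e]splitr ltrD.
Qed.

Lemma lebesgue_eball_fin (r : R) : 0 < r -> (lebesgue (eball n r) < +oo)%E.
Proof.
move=> r0.
apply: (@le_lt_trans _ _
    (lebesgue_outer (box (const_mx (- r), const_mx (- r) + const_mx (2 * r))))).
  apply: le_lebesgue_outer => x xr i; rewrite /= !mxE.
  have := le_lt_trans (ler_coord_enorm x i) xr; rewrite ltr_norml; lra.
by rewrite lebesgue_outer_cube ?ltry// mulr_gt0.
Qed.

End compactly_supported.

(** * Young functions *)

Section young_function_facts.
Context {R : realType}.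
Variable Phi : R -> R.
Hypothesis Phi_young : young Phi.

Lemma young_ge0 t : 0 <= t -> 0 <= Phi t.
Proof. by case: Phi_young => -[H _] _ _ _ _; exact: H. Qed.

Lemma young_le s t : 0 <= s -> s <= t -> Phi s <= Phi t.
Proof.
move=> s0; rewrite le_eqVlt => /predU1P[->//|st].
case: Phi_young => _ H _ _ _; apply/ltW/H => //; rewrite in_itv/= andbT//.
by rewrite (le_trans s0)// ltW.
Qed.

Lemma young0 : Phi 0 = 0.
Proof.
apply/eqP; rewrite eq_le young_ge0// andbT leNgt; apply/negP => P0.
case: Phi_young => _ _ _ /cvgrPdist_lt/(_ _ ltr01) H _.
have : \forall t \near (0 : R)^'+, False.
  near=> t.
  have t0 : 0 < t by [].
  have tP : t < Phi 0 by near: t; exact: nbhs_right_lt.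
  have : `|0 - Phi t / t| < 1 by near: t.
  have Pt : Phi 0 <= Phi t by rewrite young_le// ltW.
  rewrite sub0r normrN ger0_norm; last by rewrite divr_ge0 ?young_ge0// ltW.
  by rewrite ltr_pdivrMr// mul1r ltNge (le_trans (ltW tP)).
by move=> /filter_ex[].
Unshelve. all: by end_near. Qed.

Lemma young_convex (s a b : R) : 0 <= s -> s <= 1 -> 0 <= a -> 0 <= b ->
  Phi (s * a + (1 - s) * b) <= s * Phi a + (1 - s) * Phi b.
Proof.
move=> s0 s1 a0 b0; case: Phi_young => _ _ H _ _.
have := H (Itv01 s0 s1) a b; rewrite !inE/= !in_itv/= !andbT => /(_ a0 b0).
by rewrite !convRE.
Qed.

Lemma young_scale_le (s t : R) : 0 <= s -> s <= 1 -> 0 <= t -> Phi (s * t) <= s * Phi t.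
Proof.
move=> s0 s1 t0; have := young_convex s0 s1 t0 (lexx 0).
by rewrite young0 !mulr0 !addr0.
Qed.

(** Induction on the number of points: the mean of m + 1 numbers is a convex
combination of the first one and of the mean of the others. *)
Lemma young_jensen (I : Type) (s : seq I) (a : I -> R) : (0 < size s)%N ->
  (forall i, 0 <= a i) ->
  Phi ((size s)%:R^-1 * \sum_(i <- s) a i) <= (size s)%:R^-1 * \sum_(i <- s) Phi (a i).
Proof.
move=> + a0; elim: s => //= x [|y s] IH _.
  by rewrite !big_seq1 invr1 !mul1r.
have {}IH := IH isT; move: IH; set t := y :: s.
have : (0 < size t)%N by []; clearbody t => t_gt0.
set m : R := (size t)%:R => IH.
have m0 : 0 < m by rewrite ltr0n.
have -> : (size t).+1%:R = 1 + m :> R by rewrite -natr1 addrC.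
rewrite !big_cons.
have q0 : 0 <= (1 + m)^-1 by rewrite invr_ge0; lra.
have q1 : (1 + m)^-1 <= 1 by rewrite invf_le1; lra.
have qE : 1 - (1 + m)^-1 = (1 + m)^-1 * m by field; rewrite gt_eqF//; lra.
have S0 : 0 <= m^-1 * \sum_(i <- t) a i.
  by rewrite mulr_ge0 ?invr_ge0 ?(ltW m0)// sumr_ge0.
have -> : (1 + m)^-1 * (a x + \sum_(j <- t) a j) =
    (1 + m)^-1 * a x + (1 - (1 + m)^-1) * (m^-1 * \sum_(i <- t) a i).
  by rewrite qE -mulrA mulVKf ?gt_eqF// mulrDr.
apply: le_trans (young_convex q0 q1 (a0 x) S0) _.
by rewrite qE mulrDr lerD2l -mulrA ler_wpM2l// -ler_pdivlMl.
Qed.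

(** Phi(t) >= t for large t because t / Phi(t) tends to 0. *)
Lemma le_young_affine : exists2 M : R, 0 <= M & forall t, 0 <= t -> t <= M + Phi t.
Proof.
case: Phi_young => _ _ _ _ /cvgrPdist_lt/(_ _ ltr01)[M [Mr HM]].
exists (Num.max M 0) => [|t t0]; first by rewrite le_max lexx orbT.
have [tM|Mt] := leP t M; first by rewrite (le_trans tM)// ler_wpDr ?young_ge0// le_max lexx.
have [P0|P0] := leP (Phi t) 0.
  have -> : t = 0; last by rewrite addr_ge0 ?young_ge0// le_max lexx orbT.
  apply/eqP; rewrite eq_le t0 andbT leNgt; apply/negP => tgt0.
  case: Phi_young => _ /(_ 0 t) H _ _ _; move: H.
  rewrite !in_itv/= lexx t0 => /(_ isT isT tgt0).
  by rewrite young0 ltNge P0.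
have := HM t Mt; rewrite sub0r normrN ger0_norm; last by rewrite divr_ge0// ltW.
by rewrite ltr_pdivrMr// mul1r => /ltW h; rewrite ler_wpDl// le_max lexx orbT.
Qed.

(** [Phi] is only known to be continuous on the nonnegative half line, so it is
composed with max(0, .). *)
Lemma measurable_young_norm d (T : measurableType d) (D : set T) (g : T -> \bar R) :
  measurable_fun D g -> measurable_fun D (fun x => er_map Phi `|g x|%E).
Proof.
move=> mg.
have mP : measurable_fun setT (fun t : R => Phi (Num.max 0 t)).
  case: Phi_young => -[_ cP] _ _ _ _.
  have mPhi : measurable_fun (`[0, +oo[%classic : set R) Phi.
    by apply: subspace_continuous_measurable_fun.
  have mmax : measurable_fun [set: R] (fun t : R => Num.max 0 t).
    by apply: measurable_maxr => //; exact: measurable_id.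
  apply: (@measurable_comp _ _ _ _ _ _ (`[0, +oo[%classic : set R) Phi setT
    (fun t : R => Num.max 0 t) _ _ mPhi mmax) => //.
  by move=> _ [x _ <-] /=; rewrite in_itv/= andbT le_max lexx.
rewrite (_ : (fun x => _) = (er_map (fun t : R => Phi (Num.max 0 t)) \o (fun x => `|g x|%E))).
  apply: measurableT_comp; first exact: measurable_er_map.
  by apply: measurableT_comp => //; exact: abse_measurable.
apply/funext => x /=; case: (g x) => [z| |]//=.
by rewrite max_r.
Qed.

Lemma measurable_young d (T : measurableType d) (D : set T) (g : T -> R) :
  (forall x, 0 <= g x) -> measurable_fun D g ->
  measurable_fun D (fun x => (Phi (g x))%:E).
Proof.
move=> g0 mg; have H := measurable_young_norm (g := EFin \o g) (D := D).
rewrite (_ : (fun x => _) = (fun x => er_map Phi `|(EFin \o g) x|%E)).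
  by apply: H; exact/measurable_EFinP.
by apply/funext => x /=; rewrite ger0_norm.
Qed.

Lemma er_young_ge0 (z : \bar R) : (0 <= er_map Phi `|z|)%E.
Proof. by case: z => [r| |] //=; rewrite lee_fin young_ge0. Qed.

Hypothesis Phi_doubling : doubling Phi.

(** Iterate the doubling condition until 2^k >= L. *)
Lemma young_dilation (L : R) : 0 <= L ->
  exists2 D : R, 0 < D & forall t, 0 <= t -> Phi (L * t) <= D * Phi t.
Proof.
move=> L0; have [D D0 HD] := Phi_doubling.
have pow k t : 0 <= t -> Phi (2 ^+ k * t) <= D ^+ k * Phi t.
  elim: k t => [|k IH] t t0; first by rewrite !expr0 !mul1r.
  rewrite !exprS -mulrA (le_trans (HD _ _))// ?mulr_ge0// ?exprn_ge0//.
  by rewrite -mulrA ler_wpM2l ?IH// ltW.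
exists (D ^+ Num.bound L) => [|t t0]; first by rewrite exprn_gt0.
apply: le_trans (pow _ _ t0); apply: young_le; first by rewrite mulr_ge0.
rewrite ler_wpM2r// (le_trans (ltW (archi_boundP L0)))// -natrX ler_nat ltnW//.
exact: ltn_expl.
Qed.

Lemma youngD_le : exists2 D : R, 0 < D & forall s t, 0 <= s -> 0 <= t ->
  Phi (s + t) <= D * (Phi s + Phi t).
Proof.
have [D D0 HD] := Phi_doubling; exists D => // s t s0 t0.
wlog st : s t s0 t0 / s <= t => [H|].
  have [st|/ltW ts] := leP s t; first exact: H.
  by rewrite addrC [Phi s + _]addrC; exact: H.
apply: (@le_trans _ _ (Phi (2 * t))); first by apply: young_le; lra.
apply: le_trans (HD _ t0) _; rewrite ler_wpM2l ?(ltW D0)// lerDr.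
exact: young_ge0.
Qed.

End young_function_facts.

(** * Smooth approximation in the Orlicz-Sobolev norm *)

Section luxemburg_to_integral.
Local Open Scope ereal_scope.
Context d (T : measurableType d) (R : realType) (mu : {measure set T -> \bar R}).
Variables (Phi : R -> R) (G : set T) (s : R).
Hypotheses (Phi_young : young Phi) (mG : measurable G) (s_gt0 : (0 < s)%R).

(** Apply t <= M + Phi(t) to t = |w| / s and integrate. *)
Lemma integral_norm_le_modular (M : R) (w : T -> \bar R) :
  measurable_fun G w ->
  (0 <= M)%R -> (forall t, 0 <= t -> t <= M + Phi t)%R ->
  \int[mu]_(x in G) er_map Phi `|s^-1%:E * w x| <= 1 ->
  \int[mu]_(x in G) `|w x| <= s%:E * (M%:E * mu G + 1).
Proof.
move=> mw M0 HM m1.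
have msw : measurable_fun G (fun x => er_map Phi `|s^-1%:E * w x|).
  by apply: measurable_young_norm => //; apply: measurable_funeM.
apply: (@le_trans _ _ (\int[mu]_(x in G)
    (s%:E * (M%:E + er_map Phi `|s^-1%:E * w x|)))).
  apply: ge0_le_integral => //.
  - by apply: measurableT_comp => //; exact: abse_measurable.
  - by apply: measurable_funeM; apply: emeasurable_funD.
  move=> x _; case: (w x) => [z| |] /=.
  - rewrite lee_fin normrM ger0_norm ?invr_ge0 ?(ltW s_gt0)//.
    by rewrite -ler_pdivrMl// HM// mulr_ge0// invr_ge0 ltW.
  - by rewrite mulry gtr0_sg ?invr_gt0// mul1e /= addey// mulry gtr0_sg// mul1e.
  - by rewrite mulrNy gtr0_sg ?invr_gt0// mul1e /= addey// mulry gtr0_sg// mul1e.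
rewrite ge0_integralZl//; last 3 first.
- by apply: emeasurable_funD.
- by move=> x _; rewrite adde_ge0 ?lee_fin// er_young_ge0.
- by rewrite lee_fin ltW.
rewrite lee_wpmul2l ?lee_fin ?(ltW s_gt0)// ge0_integralD//; last first.
  by move=> x _; exact: er_young_ge0.
by rewrite integral_cst// leeD2l.
Qed.

(** By convexity Phi(g) <= s Phi(g / s) when s <= 1. *)
Lemma integral_young_le_modular (g : T -> R) :
  (forall x, 0 <= g x)%R -> measurable_fun G g -> (s <= 1)%R ->
  \int[mu]_(x in G) er_map Phi `|s^-1%:E * (g x)%:E| <= 1 ->
  \int[mu]_(x in G) (Phi (g x))%:E <= s%:E.
Proof.
move=> g0 mg s1 m1.
have sg0 x : (0 <= s^-1 * g x)%R by rewrite mulr_ge0// invr_ge0 ltW.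
have E x : er_map Phi `|s^-1%:E * (g x)%:E| = (Phi (s^-1 * g x))%:E.
  by rewrite -EFinM /= ger0_norm.
have ms : measurable_fun G (fun x => (Phi (s^-1 * g x))%:E).
  by apply: measurable_young => //; exact: measurable_funM.
have Phi0 t : (0 <= t)%R -> (0 <= Phi t)%R by exact: young_ge0.
apply: (@le_trans _ _ (\int[mu]_(x in G) (s%:E * (Phi (s^-1 * g x))%:E))).
  apply: ge0_le_integral => //.
  - by move=> x _; rewrite lee_fin Phi0.
  - exact: measurable_young.
  - exact: measurable_funeM.
  move=> x _; rewrite -EFinM lee_fin.
  apply: le_trans (young_scale_le Phi_young (ltW s_gt0) s1 (sg0 x)).
  by rewrite mulVKf// gt_eqF.
rewrite ge0_integralZl//; last 2 first.
- by move=> x _; rewrite lee_fin Phi0.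
- by rewrite lee_fin ltW.
rewrite -[leRHS]mule1 lee_wpmul2l ?lee_fin ?(ltW s_gt0)//.
apply: le_trans m1; rewrite le_eqVlt; apply/orP; left; apply/eqP.
by apply: eq_integral => x _; rewrite E.
Qed.

End luxemburg_to_integral.

Section approximation.
Context {R : realType} {n : nat}.
Variable Phi : R -> R.
Hypothesis Phi_young : young Phi.
Local Open Scope ereal_scope.

Lemma measurable_enorm (D : set (Rspace R n)) (g : Rspace R n -> 'rV[R]_n) :
  (forall i, measurable_fun D (fun x => g x ord0 i)) ->
  measurable_fun D (fun x => enorm (g x)).
Proof.
move=> mg; apply: (@measurableT_comp _ _ _ _ _ _ (@Num.sqrt R)).
  by apply: continuous_measurable_fun; exact: sqrt_continuous.
by apply: measurable_sum => i; exact: measurable_funX.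
Qed.

Lemma modular_enorm (G : set 'rV[R]_n) (g : 'rV[R]_n -> 'rV[R]_n) :
  modular Phi G (fun x => (enorm (g x))%:E) =
  \int[lebesgue]_(x in G) (Phi (enorm (g x)))%:E.
Proof.
by apply: eq_integral => x _ /=; rewrite ger0_norm// enorm_ge0.
Qed.

Lemma luxemburg_lt (G : set 'rV[R]_n) (w : 'rV[R]_n -> \bar R) (e : R) :
  luxemburg Phi G w < e%:E -> exists s : R, [/\ (0 < s)%R, (s < e)%R &
    modular Phi G (fun x => s^-1%:E * w x) <= 1].
Proof.
by move=> /ereal_inf_lt[_ [s [s0 ms] <-]]; rewrite lte_fin => se; exists s.
Qed.

Lemma luxemburg_ge0 (G : set 'rV[R]_n) (w : 'rV[R]_n -> \bar R) :
  0 <= luxemburg Phi G w.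
Proof. by apply: le_ereal_inf_tmp => _ [s [s0 _] <-]; rewrite lee_fin ltW. Qed.

Lemma measurable_gradient_coord (f : 'rV[R]_n -> R) (D : set (Rspace R n)) i :
  smooth f -> measurable_fun D (fun x : Rspace R n => gradient f x ord0 i).
Proof.
move=> sf; rewrite (_ : (fun x => _) = partial i f).
  by apply: continuous_measurable_Rspace; exact: smooth_partial_continuous.
by apply/funext => x; rewrite mxE.
Qed.

(** If a Luxemburg norm is below e, then for some s < e the modular at scale s
is at most 1; the two integral bounds above convert this into smallness of plain
integrals. *)
Lemma W10_approx (r : R) (u : 'rV[R]_n -> \bar R) (Du : 'rV[R]_n -> 'rV[R]_n) :
  (0 < r)%R -> W10 Phi (eball n r) u Du -> forall eta : R, (0 < eta)%R ->
  exists F : 'rV[R]_n -> R, [/\ Cc_infty (eball n r) F,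
    \int[lebesgue]_(x in eball n r) `|u x - (F x)%:E| <= eta%:E &
    \int[lebesgue]_(x in eball n r) (Phi (enorm (Du x - gradient F x)%R))%:E <= eta%:E].
Proof.
move=> r0 [[[mu _] _ mDu _] Happ] eta eta0.
have mB : measurable (eball n r : set (Rspace R n)).
  by apply: open_measurable_Rspace; exact: open_eball.
have [M M0 HM] := le_young_affine Phi_young.
have Bfin : lebesgue (eball n r) \is a fin_num.
  by rewrite ge0_fin_numE ?lebesgue_eball_fin.
set b := fine (lebesgue (eball n r)).
have b0 : (0 <= b)%R by rewrite fine_ge0.
have Mb : (0 < M * b + 1)%R by rewrite ltr_wpDl// mulr_ge0.
pose e := Num.min 1%R (Num.min eta (eta / (M * b + 1)))%R.
have e0 : (0 < e)%R by rewrite !lt_min ltr01 eta0 divr_gt0.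
have [F CF HF] := Happ _ e0; exists F.
have sF := Cc_smooth CF.
have /luxemburg_lt[s [s0 se ms]] :
    luxemburg Phi (eball n r) (fun x => u x - (F x)%:E) < e%:E.
  by apply: le_lt_trans HF; rewrite leeDl// luxemburg_ge0.
have /luxemburg_lt[s' [s'0 s'e ms']] :
    luxemburg Phi (eball n r) (fun x => (enorm (Du x - gradient F x)%R)%:E) < e%:E.
  by apply: le_lt_trans HF; rewrite leeDr// luxemburg_ge0.
move: se s'e; rewrite !lt_min => /and3P[_ _ se] /and3P[s'1 s'e _].
split => //.
- apply: le_trans (integral_norm_le_modular Phi_young mB s0 _ M0 HM ms) _.
    apply: emeasurable_funB; first exact: mu.
    apply/measurable_EFinP.
    by apply: continuous_measurable_Rspace; exact: smooth_continuous.
  have -> : M%:E * lebesgue (eball n r) + 1 = (M * b + 1)%:E.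
    by rewrite EFinD EFinM fineK.
  rewrite -EFinM lee_fin.
  by rewrite -ler_pdivlMr// ltW.
- apply: le_trans (integral_young_le_modular Phi_young mB s'0 _ _ (ltW s'1) ms') _.
  + by move=> x; exact: enorm_ge0.
  + apply: measurable_enorm => i; rewrite (_ : (fun x => _) =
        (fun x : Rspace R n => Du x ord0 i - gradient F x ord0 i)%R).
      by apply: measurable_funB; [exact: mDu|exact: measurable_gradient_coord].
    by apply/funext => x; rewrite !mxE.
  by rewrite lee_fin ltW.
Qed.

End approximation.

(** * Energy of averages of translates *)

Section average_of_integrals.
Local Open Scope ereal_scope.

Lemma ge0_integral_average_le d (T : measurableType d) (R : realType)
    (mu : {measure set T -> \bar R}) (D : set T) (I : Type) (s : seq I)
    (G : I -> T -> \bar R) (E : \bar R) :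
  measurable D -> (0 < size s)%N ->
  (forall i, measurable_fun D (G i)) -> (forall i x, 0 <= G i x) ->
  (forall i, \int[mu]_(x in D) G i x <= E) -> 0 <= E ->
  \int[mu]_(x in D) ((size s)%:R^-1%:E * \sum_(i <- s) G i x) <= E.
Proof.
move=> mD s0 mG G0 GE E0.
have sz : (0 < (size s)%:R :> R)%R by rewrite ltr0n.
rewrite ge0_integralZl//; [|exact: emeasurable_sum|
  by move=> x _; apply: sume_ge0].
rewrite ge0_integral_sum//.
apply: (@le_trans _ _ ((size s)%:R^-1%:E * ((size s)%:R%:E * E))); last first.
  by rewrite muleA -EFinM mulVf ?mul1e// gt_eqF.
rewrite lee_wpmul2l ?lee_fin ?invr_ge0//.
elim: (s) => [|y t IH]; first by rewrite big_nil mul0e.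
rewrite big_cons /= -natr1 addrC EFinD ge0_muleDl ?lee_fin// mul1e.
by apply: leeD => //; exact: GE.
Qed.

End average_of_integrals.

Section averaged_energy.
Context {R : realType} {n : nat}.
Variable Phi : R -> R.
Hypothesis Phi_young : young Phi.
Implicit Types (f : 'rV[R]_n -> R) (G : set 'rV[R]_n).

Lemma gradient_eq0 G f x : Cc_infty G f -> ~ G x -> gradient f x = 0.
Proof.
move=> [_ _ fG] Gx; apply/rowP => i; rewrite !mxE /partial.
transitivity ('D_(delta_mx 0 i) (cst (0 : R)) x); last by rewrite derive_cst.
apply: near_eq_derive.
have : nbhs x (~` closure [set x | f x != 0]).
  by apply: open_nbhs_nbhs; split; [apply: closed_openC; exact: closed_closure|move=> /fG].
apply: filterS => z zf /=; apply/eqP; apply/negPn/negP => fz.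
by apply: zf; exact: subset_closure.
Qed.

(** The factor 2 compensates for the loss in the lower bound for Riemann sums,
which is 1/2 instead of 1. *)
Definition shifted_average (l : R) (s : seq 'rV[R]_n) f (x : 'rV[R]_n) : R :=
  \sum_(y <- s) 2 / (size s)%:R * f (l *: x + y).

Lemma Cc_shifted_average (r l : R) (s : seq 'rV[R]_n) f : 1 < l ->
  (forall y, y \in s -> enorm y <= (l - 1) * r) -> 0 < r ->
  Cc_infty (eball n r) f -> Cc_infty (eball n r) (shifted_average l s f).
Proof.
move=> l1 sr r0 Bf.
rewrite (_ : shifted_average l s f = (fun x => \sum_(y <- s)
   if enorm y <= (l - 1) * r then 2 / (size s)%:R * f (l *: x + y) else 0)).
  apply: Cc_sum => y; case: (boolP (enorm y <= (l - 1) * r)) => yr; last exact: Cc0.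
  exact: (CcZ (2 / (size s)%:R) (Cc_affine l1 yr Bf)).
apply/funext => x; rewrite /shifted_average big_seq [RHS]big_seq; apply: eq_bigr => y ys.
by rewrite sr.
Qed.

Lemma smooth_sum (I : Type) (s : seq I) (F : I -> 'rV[R]_n -> R) :
  (forall i, smooth (F i)) -> smooth (fun x => \sum_(i <- s) F i x).
Proof.
move=> HF; elim: s => [|a s IH].
  have -> : (fun x => \sum_(i <- [::]) F i x) = (fun=> 0).
    by apply/funext => x; rewrite big_nil.
  exact: smooth_cst.
have -> : (fun x => \sum_(i <- a :: s) F i x) = F a \+ (fun x => \sum_(i <- s) F i x).
  by apply/funext => x; rewrite big_cons.
exact: (smoothD (HF a) IH).
Qed.

Lemma gradient_sum (I : Type) (s : seq I) (F : I -> 'rV[R]_n -> R) x :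
  (forall i, smooth (F i)) ->
  gradient (fun x => \sum_(i <- s) F i x) x = \sum_(i <- s) gradient (F i) x.
Proof.
move=> HF; elim: s => [|a s IH].
  rewrite big_nil; have -> : (fun x => \sum_(i <- [::]) F i x) = (fun=> 0).
    by apply/funext => z; rewrite big_nil.
  by apply/rowP => i; rewrite !mxE /partial derive_cst.
rewrite big_cons -IH -gradientD//; last exact: smooth_sum.
by congr gradient; apply/funext => z; rewrite big_cons.
Qed.

(** The constant 4 is the factor 2 of the average times the bound l <= 2 for the
dilation. *)
Lemma enorm_gradient_shifted_average (l : R) (s : seq 'rV[R]_n) f x : 0 <= l <= 2 ->
  smooth f -> enorm (gradient (shifted_average l s f) x) <=
    (size s)%:R^-1 * \sum_(y <- s) 4 * enorm (gradient f (l *: x + y)).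
Proof.
move=> /andP[l0 l2] sf; rewrite /shifted_average gradient_sum; last first.
  move=> y; apply: (smoothM (smooth_cst _)); exact: smooth_affine.
apply: le_trans (ler_enorm_sum _ _) _; rewrite mulr_sumr; apply: ler_sum => y _.
rewrite (gradientZ (2 / (size s)%:R) (f := fun z => f (l *: z + y))); last exact: smooth_affine.
rewrite gradient_affine// !enormZ !ger0_norm ?mulr_ge0 ?invr_ge0//.
have s0 : 0 <= (size s)%:R^-1 :> R by rewrite invr_ge0.
have e0 := enorm_ge0 (gradient f (l *: x + y)).
rewrite [leLHS](_ : _ = (size s)%:R^-1 * (2 * l * enorm (gradient f (l *: x + y)))); last by ring.
rewrite ler_wpM2l// ler_wpM2r//; lra.
Qed.

Lemma continuousZ_enorm_gradient (c : R) f : smooth f ->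
  continuous (fun x => c * enorm (gradient f x)).
Proof.
move=> sf x.
have h1 : {for x, continuous (cst c : 'rV[R]_n -> R)} by exact: cst_continuous.
exact: (continuousM h1 (@continuous_enorm_gradient _ _ _ sf x)).
Qed.

Lemma measurable_young_continuous (D : set (Rspace R n)) (g : 'rV[R]_n -> R) :
  (forall x, 0 <= g x) -> continuous g ->
  measurable_fun D (fun x : Rspace R n => (Phi (g x))%:E).
Proof.
move=> g0 cg.
have mg := @continuous_measurable_Rspace R n D g cg.
exact: (@measurable_young R Phi Phi_young _ (Rspace R n) D g g0 mg).
Qed.

Local Open Scope ereal_scope.

(** Jensen's inequality bounds the energy of the average by the average of
the energies of the translates, and each of these is bounded by the change of
variables; f vanishes off the ball, so integrals over the ball and over the whole
space agree. *)
Lemma energy_shifted_average (r l : R) (s : seq 'rV[R]_n) f :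
  (1 <= l <= 2)%R -> (0 < size s)%N -> Cc_infty (eball n r) f ->
  \int[lebesgue]_(x in eball n r) (Phi (enorm (gradient (shifted_average l s f) x)))%:E <=
  \int[lebesgue]_(x in eball n r) (Phi (4 * enorm (gradient f x))%R)%:E.
Proof.
move=> /andP[l1 l2] s0 Bf; have sf := Cc_smooth Bf.
have mB : measurable (eball n r : set (Rspace R n)).
  by apply: open_measurable_Rspace; exact: open_eball.
have P0 x : (0 <= Phi (4 * enorm (gradient f x)))%R.
  by rewrite young_ge0// mulr_ge0// enorm_ge0.
have ssm : smooth (shifted_average l s f).
  apply: smooth_sum => y; apply: (smoothM (smooth_cst _)); exact: smooth_affine.
have cg : continuous (fun x => 4 * enorm (gradient f x))%R.
  by apply: continuousZ_enorm_gradient.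
have mg (y : 'rV[R]_n) (D : set (Rspace R n)) : measurable_fun D
    (fun x : Rspace R n => (Phi (4 * enorm (gradient f (l *: x + y)))%R)%:E).
  apply: (measurable_young_continuous (g := fun x => 4 * enorm (gradient f (l *: x + y)))%R).
    by move=> x; rewrite mulr_ge0// enorm_ge0.
  move=> x; apply: (@continuous_comp _ _ _ (fun x : 'rV[R]_n => l *: x + y)%R
    (fun x => 4 * enorm (gradient f x))%R).
    exact: affine_continuous.
  exact: cg.
have mg0 (D : set (Rspace R n)) : measurable_fun D
    (fun x : Rspace R n => (Phi (4 * enorm (gradient f x))%R)%:E).
  apply: (measurable_young_continuous (g := fun x => 4 * enorm (gradient f x))%R) cg.
  by move=> x; rewrite mulr_ge0// enorm_ge0.
set E := \int[lebesgue]_(x in _) (Phi (4 * enorm (gradient f x)))%:E.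
have E0 : 0 <= E by apply: integral_ge0 => x _; rewrite lee_fin.
have EE : E = \int[lebesgue]_x (Phi (4 * enorm (gradient f x))%R)%:E.
  rewrite /E integral_mkcond; apply: eq_integral => x _; rewrite patchE.
  case: ifPn => // /negP xB; rewrite (gradient_eq0 Bf) ?enorm0 ?mulr0 ?young0//.
  by move=> Bx; apply: xB; rewrite inE.
have le1 (y : 'rV[R]_n) :
    \int[lebesgue]_(x in eball n r) (Phi (4 * enorm (gradient f (l *: x + y)))%R)%:E <= E.
  rewrite EE; apply: (@le_trans _ _
      (\int[lebesgue]_x (Phi (4 * enorm (gradient f (l *: x + y)))%R)%:E)).
    apply: (ge0_subset_integral _ _ _ (mg y setT)) => //.
    by move=> x _; rewrite lee_fin.
  have := @ge0_integral_affine_le R n l y _ l1 _ (mg0 setT).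
  by apply=> x; rewrite lee_fin.
apply: le_trans (ge0_integral_average_le mB s0 (fun y => mg y _) _ le1 E0); last first.
  by move=> y x; rewrite lee_fin.
have h1 x : eball n r x -> 0 <= (Phi (enorm (gradient (shifted_average l s f) x)))%:E.
  by move=> _; rewrite lee_fin young_ge0// enorm_ge0.
have mh1 : measurable_fun (eball n r : set (Rspace R n))
    (fun x : Rspace R n => (Phi (enorm (gradient (shifted_average l s f) x)))%:E).
  apply: (measurable_young_continuous (g := fun x => enorm (gradient (shifted_average l s f) x))).
    by move=> x; exact: enorm_ge0.
  exact: continuous_enorm_gradient.
have mh2 : measurable_fun (eball n r : set (Rspace R n)) (fun x : Rspace R n =>
    (size s)%:R^-1%:E * \sum_(y <- s) (Phi (4 * enorm (gradient f (l *: x + y)))%R)%:E).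
  apply: measurable_funeM.
  exact: (@emeasurable_sum _ _ _ _ _ _ (fun y (x : Rspace R n) =>
    (Phi (4 * enorm (gradient f (l *: x + y)))%R)%:E)).
refine (@ge0_le_integral _ _ _ lebesgue _ mB _ _ h1 mh1 mh2 _) => x _.
rewrite sumEFin -EFinM lee_fin.
apply: (@le_trans _ _ (Phi ((size s)%:R^-1 * \sum_(y <- s) 4 * enorm (gradient f (l *: x + y))))).
  apply: (young_le Phi_young); first exact: enorm_ge0.
  by apply: enorm_gradient_shifted_average => //; lra.
by apply: young_jensen => // y; rewrite mulr_ge0// enorm_ge0.
Qed.

End averaged_energy.

(** * Riemann sums over a grid *)

Section sum_over_cells.
Local Open Scope ereal_scope.

Lemma ge0_sum_cells_le_integral d (T : measurableType d) (R : realType)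
    (mu : {measure set T -> \bar R}) (D : set T) (I : finType)
    (A : I -> set T) (m : I -> R) (h : T -> \bar R) :
  measurable D -> (forall i, measurable (A i)) -> (forall i, A i `<=` D) ->
  (forall i j z, A i z -> A j z -> i = j) -> (forall i, 0 <= m i)%R ->
  measurable_fun D h -> (forall z, D z -> 0 <= h z) ->
  (forall i z, A i z -> (m i)%:E <= h z) ->
  \sum_(i : I) (m i)%:E * mu (A i) <= \int[mu]_(z in D) h z.
Proof.
move=> mD mA AD Aij m0 mh h0 mAh.
rewrite (eq_bigr (fun i => \int[mu]_(z in D) ((m i)%:E * (\1_(A i) z)%:E))); last first.
  move=> i _; rewrite ge0_integralZl//.
  - by rewrite integral_indic// setIidl.
  - by apply/measurable_EFinP; exact: measurable_indic.
  - by rewrite lee_fin.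
rewrite -ge0_integral_sum//; last 2 first.
- move=> i; apply: measurable_funeM; apply/measurable_EFinP; exact: measurable_indic.
- by move=> i z _; rewrite mule_ge0// lee_fin.
apply: ge0_le_integral => //.
- by move=> z _; apply: sume_ge0 => i _; rewrite mule_ge0// lee_fin.
- apply: emeasurable_sum => i; apply: measurable_funeM; apply/measurable_EFinP.
  exact: measurable_indic.
move=> z Dz; have [[i iz]|nz] := pselect (exists i, A i z); last first.
  rewrite big1; first exact: h0.
  move=> i _; rewrite indicE memNset ?mule0//.
  by move=> iz; apply: nz; exists i.
rewrite (bigD1 i)//= big1 ?adde0; last first.
  move=> j ji; rewrite indicE memNset ?mule0//.
  by move=> jz; move/eqP: ji; apply; exact: Aij jz iz.
by rewrite indicE mem_set// mule1 mAh.
Qed.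

End sum_over_cells.

Section grid_average.
Context {R : realType} {n : nat}.

Definition grid_point (d : R) (N : nat) (i : {ffun 'I_n -> 'I_N}) : 'rV[R]_n :=
  \row_j (d / N%:R * (i j)%:R).

Definition grid (d : R) (N : nat) : seq 'rV[R]_n :=
  [seq grid_point d i | i <- enum {ffun 'I_n -> 'I_N}].

Lemma size_grid d N : size (grid d N) = (N ^ n)%N.
Proof. by rewrite size_map -cardE card_ffun !card_ord. Qed.

Lemma grid_point_bounds d N (i : {ffun 'I_n -> 'I_N}) j : 0 <= d ->
  0 <= grid_point d i 0 j <= d.
Proof.
move=> d0; have N0 : (0 < N)%N by apply: leq_ltn_trans (ltn_ord (i j)).
rewrite mxE mulr_ge0 ?divr_ge0//= -mulrA ler_piMr// ler_pdivrMl ?ltr0n// mulr1.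
by rewrite ler_nat ltnW.
Qed.

Lemma mem_grid_enorm d N y : 0 <= d -> y \in grid d N -> enorm y <= n%:R * d.
Proof.
move=> d0 /mapP[i _ ->]; apply: enorm_le_coord => // j.
by have /andP[h1 h2] := grid_point_bounds i j d0; rewrite ger0_norm.
Qed.

(** Half-open cells, translated by p, of the subdivision of a cube of side d into
N^n equal cubes; they are disjoint and [grid_point d i] is a corner. *)
Definition grid_cell (p : 'rV[R]_n) d N (i : {ffun 'I_n -> 'I_N}) : set 'rV[R]_n :=
  box (p + grid_point d i, p + grid_point d i + const_mx (d / N%:R)).

Lemma grid_cell_inj p d N (i i' : {ffun 'I_n -> 'I_N}) z : 0 < d ->
  grid_cell p d i z -> grid_cell p d i' z -> i = i'.
Proof.
move=> d0 iz i'z; apply/ffunP => j.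
have N0 : (0 < N)%N by apply: leq_ltn_trans (ltn_ord (i j)).
have w0 : 0 < d / N%:R by rewrite divr_gt0// ltr0n.
have := iz j; have := i'z j; rewrite /= !mxE => /andP[a b] /andP[a' b'].
have lt1 : d / N%:R * (i j)%:R < d / N%:R * (i' j).+1%:R.
  by rewrite -natr1 mulrDr mulr1; lra.
have lt2 : d / N%:R * (i' j)%:R < d / N%:R * (i j).+1%:R.
  by rewrite -natr1 mulrDr mulr1; lra.
move: lt1 lt2; rewrite !ltr_pM2l// !ltr_nat !ltnS => le1 le2.
by apply/val_inj/eqP; rewrite /= eqn_leq le1.
Qed.

Lemma grid_cell_sub p d N (i : {ffun 'I_n -> 'I_N}) z j : 0 <= d ->
  grid_cell p d i z -> p 0 j < z 0 j <= p 0 j + d.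
Proof.
move=> d0 /(_ j); rewrite /= !mxE => /andP[a b].
have N0 : (0 < N)%N by apply: leq_ltn_trans (ltn_ord (i j)).
have /andP[h1 _] := grid_point_bounds i j d0; rewrite mxE in h1.
have h2 : d / N%:R * (i j)%:R + d / N%:R <= d.
  rewrite -[X in _ + X]mulr1 -mulrDr natr1 -mulrA ler_piMr//.
  by rewrite ler_pdivrMl ?ltr0n// mulr1 ler_nat.
apply/andP; split; lra.
Qed.

Lemma grid_cell_dist p d N (i : {ffun 'I_n -> 'I_N}) z : 0 <= d ->
  grid_cell p d i z -> `|p + grid_point d i - z| <= d / N%:R.
Proof.
move=> d0 iz; have dN : 0 <= d / N%:R by rewrite divr_ge0.
rewrite [leLHS]/Num.norm /= mx_normrE; apply/bigmax_leP; split => //.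
move=> [a j] _ /=; rewrite (ord1 a); have := iz j; rewrite /= !mxE ler_norml; lra.
Qed.

Local Open Scope ereal_scope.

(** Let m_i be the positive part of 3/4 - W at the corner of the cell i.  As W
oscillates by at most 1/4 on a cell, m_i <= 1 - W <= h there unless m_i = 0.
Integrating, the mean of the m_i is at most 1/4, and therefore the mean of the
values of W at the corners is at least 3/4 - 1/4 = 1/2. *)
Lemma grid_average_ge (W : 'rV[R]_n -> R) (O : set (Rspace R n))
    (h : Rspace R n -> \bar R) (p : 'rV[R]_n) (d : R) (N : nat) :
  (0 < d)%R -> (0 < N)%N -> measurable O ->
  measurable_fun O h -> (forall z, O z -> 0 <= h z) ->
  \int[lebesgue]_(z in O) h z <= (d ^+ n / 4)%:E ->
  (forall z, O z -> (1 - W z)%:E <= h z) ->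
  (forall z : 'rV[R]_n, (forall j, p 0 j < z 0 j <= p 0 j + d)%R -> O z) ->
  (forall (i : {ffun 'I_n -> 'I_N}) z, grid_cell p d i z ->
     (`|W (p + grid_point d i) - W z| <= 4^-1)%R) ->
  ((size (grid d N))%:R / 2 <= \sum_(y <- grid d N) W (p + y))%R.
Proof.
move=> d0 N0 mO mh h0 hd Wh pO Wosc.
pose m (i : {ffun 'I_n -> 'I_N}) : R := (Num.max 0 (3 / 4 - W (p + grid_point d i)))%R.
have m0 i : (0 <= m i)%R by rewrite le_max lexx.
have dN : (0 < d / N%:R)%R by rewrite divr_gt0// ltr0n.
have mcell i : measurable (grid_cell p d i : set (Rspace R n)) by exact: measurable_box.
have : \sum_(i in {ffun 'I_n -> 'I_N}) (m i * (d / N%:R) ^+ n)%:E <= (d ^+ n / 4)%:E.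
  apply: le_trans hd.
  have cellO i : @grid_cell p d N i `<=` O.
    by move=> z iz; apply: pO => j; exact: grid_cell_sub (ltW d0) iz.
  have mh' i z : @grid_cell p d N i z -> (m i)%:E <= h z.
    move=> iz; have Oz := cellO _ _ iz; rewrite /m; have := Wosc _ _ iz.
    rewrite ler_norml => /andP[w1 w2].
    case: (leP 0%R (3 / 4 - W (p + grid_point d i))%R) => _; last exact: h0.
    by apply: le_trans (Wh _ Oz); rewrite lee_fin; lra.
  have := ge0_sum_cells_le_integral lebesgue mO (@mcell N) cellO
    (fun i j z => @grid_cell_inj p d N i j z d0) m0 mh h0 mh'.
  apply: le_trans; rewrite le_eqVlt; apply/orP; left; apply/eqP.
  apply: eq_bigr => i _; rewrite EFinM; congr (_ * _).
  exact: (esym (lebesgue_outer_cube (p + grid_point d i)%R dN)).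
rewrite sumEFin lee_fin -mulr_suml expr_div_n => hm.
have Nn : (0 < N%:R ^+ n :> R)%R by rewrite exprn_gt0// ltr0n.
have dn : (0 < d ^+ n)%R by rewrite exprn_gt0.
have {}hm : (\sum_(i in {ffun 'I_n -> 'I_N}) m i <= N%:R ^+ n / 4)%R.
  rewrite -(@ler_pM2r _ (d ^+ n / N%:R ^+ n)) ?divr_gt0//.
  apply: le_trans hm _; rewrite le_eqVlt; apply/orP; left; apply/eqP.
  by field; rewrite gt_eqF.
rewrite size_grid natrX /grid big_map big_enum/=.
have card : (\sum_(i in {ffun 'I_n -> 'I_N}) (3 / 4 : R) = N%:R ^+ n * (3 / 4))%R.
  by rewrite sumr_const -[LHS]mulr_natl card_ffun !card_ord natrX.
have : (\sum_(i in {ffun 'I_n -> 'I_N}) (3 / 4 - m i) <=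
    \sum_(i in {ffun 'I_n -> 'I_N}) W (p + grid_point d i))%R.
  apply: ler_sum => i _; rewrite /m.
  by case: (leP 0%R (3 / 4 - W (p + grid_point d i))%R) => ?; lra.
rewrite sumrB card; lra.
Qed.

End grid_average.

(** * Level sets of quasicontinuous functions *)

Lemma closed_within_preimage (T U : topologicalType) (A : set T) (g : T -> U) (C : set U) :
  closed A -> {within A, continuous g} -> closed C -> closed (A `&` g @^-1` C).
Proof.
move=> cA cg cC.
have : closed (g @^-1` C : set (subspace A)) by move/continuous_closedP : cg; exact.
move=> /closed_subspaceP[V cV VA].
by rewrite setIC -VA; exact: closedI.
Qed.

Section quasicontinuous_level_sets.
Context {R : realType} {n : nat}.
Variable Phi : R -> R.
Local Open Scope ereal_scope.

Lemma bounded_subset_eball (r : R) (K : set 'rV[R]_n) : K `<=` eball n r -> bounded_set K.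
Proof.
move=> KB; exists r; split; first exact: num_real.
move=> M rM x /KB xr; apply: le_trans (ler_norm_enorm x) _.
exact: le_trans (ltW xr) (ltW rM).
Qed.

(** The extension of u by 0 is continuous on the closed set outside V.  Hence V
together with {|u| > t/2} is open, and {|u| >= t} minus V is closed; it is
compact inside the open ball because the extension vanishes off the ball.
Since v is continuous, {v >= 1} is a compact set containing V, so that it can
replace V in K. *)
Lemma quasicontinuous_level_set (r t e : R) (u : 'rV[R]_n -> \bar R) :
  (0 < t)%R -> (0 < e)%R -> quasicontinuous Phi r u ->
  exists (v : 'rV[R]_n -> R) (O K : set 'rV[R]_n),
    [/\ [/\ Cc_infty (eball n r) v,
            \int[lebesgue]_(x in eball n r) (Phi (enorm (gradient v x)))%:E < e%:E &
            (forall x, O x -> (4^-1 <= v x)%R \/ (t / 2)%:E < `|u x|)],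
        open O /\ O `<=` eball n r,
        compact K /\ K `<=` O &
        [set x | eball n r x /\ t%:E < `|u x|] `<=` K].
Proof.
move=> t0 e0 /(_ e e0)[V [oV VB capV cu]].
have [_ [v [Bv vV] <-]] := ereal_inf_lt capV; rewrite modular_enorm => ev.
pose u' := u \_ (eball n r).
have cv := smooth_continuous (Cc_smooth Bv).
have cV : closed (~` V) by exact: open_closedC.
have cau : {within ~` V, continuous (fun x => `|u' x|)}.
  move=> x; apply: (@continuous_comp _ _ _ (u' : subspace (~` V) -> _) abse).
    exact: cu.
  exact: abse_continuous.
have u'B x : 0 < `|u' x| -> eball n r x.
  by rewrite /u' patchE; case: ifPn => [/set_mem//|_]; rewrite abse0 ltxx.
have u'E x : eball n r x -> u' x = u x by move=> xB; rewrite /u' patchE mem_set.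
have vB x : (0 < v x)%R -> eball n r x.
  by move=> vx; apply: contrapT => /(Cc_eq0 Bv) v0; move: vx; rewrite v0 ltxx.
pose P := V `|` [set x | (t / 2)%:E < `|u' x|].
have oP : open P.
  rewrite -[P]setCK; apply: closed_openC.
  rewrite (_ : ~` P = ~` V `&` (fun x => `|u' x|) @^-1` [set z | z <= (t / 2)%:E]).
    by apply: closed_within_preimage => //; exact: closed_ereal_ge_ereal.
  by rewrite /P setCU; congr (_ `&` _); apply/seteqP; split => x /=;
    rewrite leNgt => /negP.
pose O := P `|` [set x | (4^-1 < v x)%R].
have oO : open O.
  apply: openU => //.
  rewrite (_ : [set x | _] = v @^-1` `]4^-1%R, +oo[%classic).
    by move/continuousP : cv; apply; exact: interval_open.
  by apply/seteqP; split => x /=; rewrite in_itv/= andbT.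
pose K := [set x | (1 <= v x)%R] `|` (~` V `&` (fun x => `|u' x|) @^-1` [set z | t%:E <= z]).
have KO : K `<=` O.
  move=> x [/= vx|[_ /= xt]].
    by right => /=; apply: lt_le_trans vx; rewrite invf_lt1// ltr1n.
  left; right => /=; apply: lt_le_trans xt; rewrite lte_fin.
  by rewrite ltr_pdivrMr// ltr_pMr// ltr1n.
have OB : O `<=` eball n r.
  move=> x [[/VB//|/= xt]|/= vx].
    by apply: u'B; apply: lt_trans xt; rewrite lte_fin divr_gt0.
  by apply: vB; apply: lt_trans vx; rewrite invr_gt0.
exists v, O, K; split.
- split => // x [[/vV vx|/= xt]|/= vx].
  + by left; apply: le_trans vx; rewrite invf_le1// ler1n.
  + right; rewrite -u'E//; apply: u'B.
    by apply: lt_trans xt; rewrite lte_fin divr_gt0.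
  + by left; exact: ltW.
- by split.
- split => //; apply: bounded_closed_compact.
    by apply: (@bounded_subset_eball r) => x /KO/OB.
  apply: closedU.
    rewrite (_ : [set x | _] = v @^-1` `[1%R, +oo[%classic).
      by move/continuous_closedP : cv; apply; exact: interval_closed.
    by apply/seteqP; split => x /=; rewrite in_itv/= andbT.
  by apply: closed_within_preimage => //; exact: closed_ereal_le_ereal.
- move=> x [Bx xt]; have [Vx|nVx] := pselect (V x); first by left; exact: vV.
  by right; split => //=; rewrite u'E// ltW.
Qed.

End quasicontinuous_level_sets.

(** * Capacity of a single level set *)

Section capacity_of_level_sets.
Context {R : realType} {n : nat}.
Variable Phi : R -> R.
Hypotheses (Phi_young : young Phi) (Phi_doubling : doubling Phi).
Implicit Types (F v : 'rV[R]_n -> R) (G : set 'rV[R]_n).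

(** Smooth truncation of |F| between t/8 and t/4. *)
Definition level_cut (t : R) F : 'rV[R]_n -> R :=
  (step \o ((fun=> t^-1) \* F)) \+ (step \o ((fun=> - t^-1) \* F)).

Lemma Cc_level_cut G t F : Cc_infty G F -> Cc_infty G (level_cut t F).
Proof. by move=> GF; apply: CcD; apply: Cc_step; apply: (CcZ _ GF). Qed.

Lemma level_cut_ge0 t F x : 0 <= level_cut t F x.
Proof. by rewrite addr_ge0// step_ge0. Qed.

Lemma level_cut_ge1 t F x : 0 < t -> t / 4 <= `|F x| -> 1 <= level_cut t F x.
Proof.
move=> t0; rewrite ler_normr => /orP[tF|tF]; rewrite /level_cut /=.
  by rewrite [step (t^-1 * _)]step1 ?lerDl ?step_ge0// ler_pdivlMl.
by rewrite [step (- t^-1 * _)]step1 ?lerDr ?step_ge0// mulNr -mulrN ler_pdivlMl.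
Qed.

Local Open Scope ereal_scope.

Notation energy r v := (\int[lebesgue]_(x in eball n r) (Phi (enorm (gradient v x)))%:E).

Lemma capacity_le_energy (r : R) (E : set 'rV[R]_n) v : Cc_infty (eball n r) v ->
  (forall x, E x -> 1 <= v x)%R -> capacity Phi r E <= energy r v.
Proof.
by move=> Bv Ev; rewrite -modular_enorm; apply: ereal_inf_lbound; exists v.
Qed.

Lemma energy_cut_le : exists2 D : R, (0 < D)%R & forall (r : R) g v,
  smooth g -> smooth v ->
  \int[lebesgue]_(x in eball n r) (Phi (4 * enorm (gradient (g \+ (step \o v)) x))%R)%:E
    <= D%:E * (energy r g + energy r v).
Proof.
have [L L0 HL] := @dstep_bounded R.
have [D1 D10 H1] := youngD_le Phi_young Phi_doubling.
have [D2 D20 H2] := young_dilation Phi_young Phi_doubling (ler0n R 4).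
have [D3 D30 H3] := young_dilation Phi_young Phi_doubling (mulr_ge0 (ler0n R 4) (ltW L0)).
exists (D1 * (D2 + D3))%R => [|r g v sg sv]; first by rewrite mulr_gt0// addr_gt0.
have mB : measurable (eball n r : set (Rspace R n)).
  by apply: open_measurable_Rspace; exact: open_eball.
have ssv : smooth (step \o v) by exact: smooth_comp_step.
have mg (w : 'rV[R]_n -> R) : smooth w -> measurable_fun (eball n r : set (Rspace R n))
    (fun x : Rspace R n => (Phi (enorm (gradient w x)))%:E).
  move=> sw; apply: (measurable_young_continuous Phi_young (g := fun x => enorm (gradient w x))).
    by move=> x; exact: enorm_ge0.
  exact: continuous_enorm_gradient.
have g0 (w : 'rV[R]_n -> R) x : 0 <= (Phi (enorm (gradient w x)))%:E.
  by rewrite lee_fin; apply: young_ge0 => //; exact: enorm_ge0.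
have mL : measurable_fun (eball n r : set (Rspace R n)) (fun x : Rspace R n =>
    (Phi (4 * enorm (gradient (g \+ (step \o v)) x))%R)%:E).
  apply: (measurable_young_continuous Phi_young
    (g := fun x => 4 * enorm (gradient (g \+ (step \o v)) x))%R).
    by move=> x; rewrite mulr_ge0// enorm_ge0.
  by apply: continuousZ_enorm_gradient; exact: smoothD.
have L0' x : eball n r x -> 0 <= (Phi (4 * enorm (gradient (g \+ (step \o v)) x))%R)%:E.
  by move=> _; rewrite lee_fin young_ge0// mulr_ge0// enorm_ge0.
have mS : measurable_fun (eball n r : set (Rspace R n)) (fun x : Rspace R n =>
    (Phi (enorm (gradient g x)))%:E + (Phi (enorm (gradient v x)))%:E).
  exact: (emeasurable_funD (mg g sg) (mg v sv)).
rewrite -(@ge0_integralD _ _ _ lebesgue _ mB _ _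
  (fun x _ => g0 g x) (mg g sg) (fun x _ => g0 v x) (mg v sv)).
rewrite -(@ge0_integralZl_EFin _ _ _ lebesgue _ mB _ _ mS); last 2 first.
- by move=> x _; rewrite adde_ge0.
- by rewrite mulr_ge0 ?addr_ge0 ?(ltW D10) ?(ltW D20) ?(ltW D30).
refine (@ge0_le_integral _ _ _ lebesgue _ mB _ _ L0' mL (measurable_funeM _ mS) _) => x _.
rewrite -EFinD -EFinM lee_fin.
have e1 := enorm_ge0 (gradient g x); have e2 := enorm_ge0 (gradient v x).
apply: (@le_trans _ _ (Phi (4 * enorm (gradient g x) + 4 * L * enorm (gradient v x))%R)).
  apply: (young_le Phi_young); first exact: mulr_ge0 (ler0n _ _) (enorm_ge0 _).
  rewrite gradientD// (gradient_comp sv (is_derive_step (v x))) -mulrA -mulrDr ler_wpM2l//.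
  apply: le_trans (ler_enormD _ _) _; rewrite lerD2l enormZ ler_wpM2r//.
apply: le_trans (H1 _ _ (mulr_ge0 (ler0n _ _) e1) (mulr_ge0 (mulr_ge0 (ler0n _ _) (ltW L0)) e2)) _.
rewrite -[leRHS]mulrA ler_wpM2l ?(ltW D10)//.
have aux (a b p q A B : R) : (a <= A * p -> b <= B * q -> 0 <= A * q -> 0 <= B * p ->
    a + b <= (A + B) * (p + q))%R.
  by move=> ? ? ? ?; rewrite mulrDl !mulrDr; lra.
apply: aux (H2 _ e1) (H3 _ e2) _ _.
- exact: mulr_ge0 (ltW D20) (young_ge0 Phi_young e2).
- exact: mulr_ge0 (ltW D30) (young_ge0 Phi_young e1).
Qed.

End capacity_of_level_sets.

Section capacity_of_level_sets_bound.
Context {R : realType} {n : nat}.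
Variable Phi : R -> R.
Hypotheses (Phi_young : young Phi) (Phi_doubling : doubling Phi).
Local Open Scope ereal_scope.

Notation energy r v := (\int[lebesgue]_(x in eball n r) (Phi (enorm (gradient v x)))%:E).

(** If v < 1/4 then |z| > t/2; either |F| >= t/4 and the truncation is already 1,
or |z - F| >= t/4 and the right-hand side is at least 1. *)
Lemma cutoff_defect_le (t : R) (z : \bar R) (F v : 'rV[R]_n -> R) x : (0 < t)%R ->
  (4^-1 <= v x)%R \/ (t / 2)%:E < `|z| ->
  (1 - (level_cut t F \+ (step \o v))%R x)%:E <= (4 / t)%:E * `|z - (F x)%:E|.
Proof.
move=> t0 H.
have h0 : 0 <= (4 / t)%:E * `|z - (F x)%:E| by rewrite mule_ge0// lee_fin divr_ge0// ltW.
have [W1|W1] := leP 1%R ((level_cut t F \+ (step \o v))%R x).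
  by apply: le_trans h0; rewrite lee_fin subr_le0.
have g0 := level_cut_ge0 t F x; have s0 := step_ge0 (v x).
case: H => [v4|zt].
  by move: W1; rewrite /= step1// => W1; exfalso; lra.
have [F4|F4] := leP (t / 4)%R `|F x|%R.
  by have := level_cut_ge1 t0 F4; move: W1 => /= ? ?; exfalso; lra.
apply: (@le_trans _ _ 1); first by rewrite lee_fin /=; lra.
case: z zt {h0} => [z| |]; last 2 first.
- by move=> _; rewrite /= mulry gtr0_sg ?divr_gt0// mul1e leey.
- by move=> _; rewrite /= mulry gtr0_sg ?divr_gt0// mul1e leey.
rewrite /= lte_fin lee_fin => zt.
rewrite -ler_pdivrMl ?divr_gt0// mulr1 invf_div.
have := ler_normD (z - F x)%R (F x); rewrite subrK => ?; lra.
Qed.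

(** A cube with corner at l x is close to x when l is close to 1 and the cube is
small. *)
Lemma affine_cube_dist (r d l dl : R) (x z : 'rV[R]_n) : (1 <= l)%R ->
  (enorm x < r)%R -> ((l - 1) * r <= d / 4)%R -> (dl <= d / 4)%R -> (0 < d)%R ->
  (forall j, (l *: x)%R 0%R j < z 0%R j <= (l *: x)%R 0%R j + dl)%R -> (`|x - z| < d)%R.
Proof.
move=> l1 xr lr dl4 d0 xz.
apply: (@le_lt_trans _ _ (d / 2)%R); last by rewrite ltr_pdivrMr// ltr_pMr// ltr1n.
rewrite [leLHS]/Num.norm /= mx_normrE; apply/bigmax_leP; split.
  by rewrite divr_ge0// ltW.
move=> [a j] _ /=; rewrite (ord1 a); have := xz j; rewrite !mxE.
have : (`|x 0 j| <= r)%R by rewrite (le_trans (ler_coord_enorm x j))// ltW.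
have l10 : (0 <= l - 1)%R by lra.
move=> /(ler_wpM2l l10); set X := x 0%R j; rewrite -[X in (X * _ <= _)%R](ger0_norm l10) -normrM.
by rewrite !ler_norml => /andP[h1 h2] /andP[h3 h4]; lra.
Qed.

Lemma box_compact (M : R) : compact [set x : 'rV[R]_n | forall i, x ord0 i \in `[- M, M]%R].
Proof.
apply: (@rV_compact _ _ (fun=> `[(- M)%R, M]%classic)) => i; exact: segment_compact.
Qed.

(** The parameters are chosen in this order: V, v, O and K from t and e; the distance
d from K to the complement of O; the dilation l and the side dl of the cubes from
d, so that the cube at l x stays in O for x in K and the shifts are small enough
for the supports; the admissible L^1 error eta from t and dl; and, once F is
given, the number N of subdivisions from the modulus of continuity of W. *)
Lemma capacity_level_le : exists2 D : R, (0 < D)%R &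
  forall (r t e : R) (u : 'rV[R]_n -> \bar R), (0 < r)%R -> (0 < t)%R -> (0 < e)%R ->
    measurable_fun (eball n r : set (Rspace R n)) (u : Rspace R n -> \bar R) ->
    quasicontinuous Phi r u ->
  exists2 eta : R, (0 < eta)%R & forall F, Cc_infty (eball n r) F ->
    \int[lebesgue]_(x in eball n r) `|u x - (F x)%:E| <= eta%:E ->
    capacity Phi r [set x | eball n r x /\ t%:E < `|u x|] <=
      D%:E * (energy r (level_cut t F) + e%:E).
Proof.
have [D D0 HD] := @energy_cut_le R n Phi Phi_young Phi_doubling.
exists D => // r t e u r0 t0 e0 mu qu.
have [v [ O [K [[Bv ev HO] [oO OB] [cK KO] EK]]]] := quasicontinuous_level_set t0 e0 qu.
have [d d0 dO] := compact_dist_open cK oO KO.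
(* The point x is moved by at most tau r <= d / 4 by the dilation, and by at most
   n dl <= tau r by the translations; the second bound is what Cc_affine allows
   for the factor l = 1 + tau. *)
pose tau : R := Num.min 1%R (d / (4 * r))%R.
pose l : R := (1 + tau)%R.
have r4 : (0 < 4 * r)%R by rewrite mulr_gt0.
have tau0 : (0 < tau)%R by rewrite lt_min ltr01 divr_gt0.
have tau1 : (tau <= 1)%R by rewrite ge_min lexx.
have taur : (tau * r <= d / 4)%R.
  have : (tau <= d / (4 * r))%R by rewrite ge_min lexx orbT.
  by rewrite ler_pdivlMr// => ?; lra.
pose dl : R := Num.min (d / 4)%R (tau * r / n.+1%:R)%R.
have dl0 : (0 < dl)%R by rewrite lt_min !divr_gt0// ?mulr_gt0// ltr0n.
have dl4 : (dl <= d / 4)%R by rewrite ge_min lexx.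
have ndl : (n%:R * dl <= tau * r)%R.
  have : (dl <= tau * r / n.+1%:R)%R by rewrite ge_min lexx orbT.
  rewrite ler_pdivlMr ?ltr0n// -natr1 mulrDr mulr1 mulrC => ?; lra.
have lE : (l - 1 = tau)%R by rewrite /l addrAC subrr add0r.
have l1 : (1 < l)%R by rewrite /l ltrDl.
have l2 : (l <= 2)%R by rewrite /l; lra.
have KB x : K x -> (enorm x < r)%R by move=> /KO/OB.
have xO (x z : 'rV[R]_n) : K x ->
    (forall j, (l *: x)%R 0%R j < z 0%R j <= (l *: x)%R 0%R j + dl)%R -> O z.
  move=> Kx xz; apply: (dO x z Kx).
  by apply: affine_cube_dist (ltW l1) (KB x Kx) _ dl4 d0 xz; rewrite lE.
have dln : (0 < dl ^+ n)%R by rewrite exprn_gt0.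
(* The factor t / 4 compensates for the factor 4 / t in cutoff_defect_le, and
   dl ^+ n / 4 is the bound required in grid_average_ge. *)
exists (t / 4 * (dl ^+ n / 4))%R; first by rewrite mulr_gt0 ?divr_gt0.
move=> F BF HF.
pose W := (level_cut t F \+ (step \o v))%R.
have BW : Cc_infty (eball n r) W by apply: CcD; [exact: Cc_level_cut|exact: Cc_step].
have cW := smooth_continuous (Cc_smooth BW).
have mB : measurable (eball n r : set (Rspace R n)).
  by apply: open_measurable_Rspace; exact: open_eball.
have mO : measurable (O : set (Rspace R n)) by exact: open_measurable_Rspace.
pose h (z : Rspace R n) := (4 / t)%:E * `|u z - (F z)%:E|.
have mF (G : set (Rspace R n)) : measurable_fun G (fun z : Rspace R n => (F z)%:E).
  apply/measurable_EFinP; apply: continuous_measurable_Rspace.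
  exact: smooth_continuous (Cc_smooth BF).
have muF : measurable_fun (eball n r : set (Rspace R n)) (fun z : Rspace R n => `|u z - (F z)%:E|).
  apply: (@measurableT_comp _ _ _ _ _ _ abse); first exact: abse_measurable.
  exact: (emeasurable_funB mu (mF _)).
have mh : measurable_fun (eball n r : set (Rspace R n)) h by exact: (measurable_funeM _ muF).
have h0 z : 0 <= h z by rewrite mule_ge0// lee_fin divr_ge0// ltW.
have hd : \int[lebesgue]_(z in O) h z <= (dl ^+ n / 4)%:E.
  apply: (@le_trans _ _ (\int[lebesgue]_(z in eball n r) h z)).
    exact: (@ge0_subset_integral _ _ _ lebesgue _ _ mO mB _ mh (fun z _ => h0 z) OB).
  rewrite /h (@ge0_integralZl_EFin _ _ _ lebesgue _ mB _ _ muF).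
  - have t4 : (0 <= 4 / t)%R by rewrite divr_ge0// ltW.
    apply: le_trans (lee_wpmul2l _ HF) _; first by rewrite lee_fin.
    rewrite -EFinM lee_fin le_eqVlt; apply/orP; left; apply/eqP.
    by field; rewrite gt_eqF.
  - by move=> x _; exact: abse_ge0.
  - by rewrite divr_ge0// ltW.
have Wh z : O z -> (1 - W z)%:E <= h z by move=> /HO; exact: cutoff_defect_le.
have V4 : (0 < 4^-1 :> R)%R by rewrite invr_gt0.
(* For x in K and y in the grid the coordinates of l x + y are bounded by 2 r + d,
   since l <= 2 and the coordinates of y are at most dl <= d. *)
have [d' d'0 Hd'] := heine (@box_compact (2 * r + d)%R) cW V4.
pose N := (Num.bound (dl / d')).+1.
have N0 : (0 < N)%N by [].
have dlN : (dl / N%:R < d')%R.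
  rewrite ltr_pdivrMr ?ltr0n// mulrC -ltr_pdivrMr//.
  have dd0 : (0 <= dl / d')%R by rewrite divr_ge0// ltW.
  by rewrite (lt_trans (archi_boundP dd0))// ltr_nat.
pose T := shifted_average l (grid dl N) W.
have sz : (0 < size (@grid R n dl N))%N by rewrite size_grid expn_gt0.
have BT : Cc_infty (eball n r) T.
  apply: Cc_shifted_average => // y yg.
  by rewrite lE (le_trans (mem_grid_enorm (ltW dl0) yg)).
have KT x : K x -> (1 <= T x)%R.
  move=> Kx.
  have osc (i : {ffun 'I_n -> 'I_N}) z : grid_cell (l *: x)%R dl i z ->
      (`|W (l *: x + grid_point dl i)%R - W z| <= 4^-1)%R.
    move=> iz; apply/ltW/Hd'; last first.
      exact: le_lt_trans (grid_cell_dist (ltW dl0) iz) dlN.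
    move=> j; rewrite in_itv/= !mxE -ler_norml.
    have xj : (`|x 0 j| <= r)%R.
      by rewrite (le_trans (ler_coord_enorm x j))// ltW// KB.
    have := grid_point_bounds i j (ltW dl0); rewrite mxE => /andP[g1 g2].
    rewrite (le_trans (ler_normD _ _))// lerD//.
      by rewrite normrM ler_pM// ger0_norm// ltW// (lt_trans ltr01).
    rewrite ger0_norm// (le_trans g2)//; lra.
  have := grid_average_ge dl0 N0 mO (measurable_funS mB OB mh) (fun z _ => h0 z) hd Wh
    (fun z => xO x z Kx) osc.
  rewrite /T /shifted_average -mulr_sumr => H.
  apply: le_trans (ler_wpM2l _ H); last by rewrite divr_ge0.
  by rewrite mulrA divfK ?divff// pnatr_eq0 -lt0n.
apply: (@le_trans _ _ (energy r T)).
  by apply: capacity_le_energy => // x /EK; exact: KT.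
apply: (@le_trans _ _ (\int[lebesgue]_(x in eball n r) (Phi (4 * enorm (gradient W x))%R)%:E)).
  by apply: energy_shifted_average => //; rewrite (ltW l1).
apply: le_trans (HD r _ _ (Cc_smooth (Cc_level_cut t BF)) (Cc_smooth Bv)) _.
by rewrite lee_wpmul2l ?lee_fin ?(ltW D0)// leeD2l// ltW.
Qed.

End capacity_of_level_sets_bound.

(** * The Stieltjes measure and dyadic sums *)

Section stieltjes_measure_of_Psi.
Context {R : realType}.
Variable Psi : R -> R.
Hypothesis Psi_incr : {in `]0, +oo[ &, {homo Psi : s t / s <= t}}.
Hypothesis Psi_C1 : C1_pos Psi.
Hypothesis Psi_ge0 : forall t, 0 < t -> 0 <= Psi t.

Let A := [set Psi s | s in `]0, +oo[].

Let A_inf : has_inf A.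
Proof.
split; first by exists (Psi 1), 1 => //=; rewrite in_itv/= andbT.
by exists 0 => _ [s /= + <-]; rewrite in_itv/= andbT; exact: Psi_ge0.
Qed.

Let inf_le t : 0 < t -> inf A <= Psi t.
Proof.
move=> t0; apply: ge_inf; first exact: A_inf.2.
by exists t => //=; rewrite in_itv/= andbT.
Qed.

Lemma extend0_nondecreasing : nondecreasing (extend0 Psi).
Proof.
move=> s t st; rewrite /extend0; case: ifPn => [s0|].
  have t0 := lt_le_trans s0 st; rewrite t0; apply: Psi_incr => //.
  - by rewrite in_itv/= andbT.
  - by rewrite in_itv/= andbT.
by move=> _; case: ifPn => // t0; exact: inf_le.
Qed.

(** At 0 this holds by the choice of the value there, the infimum of Psi. *)
Lemma extend0_right_continuous :
  forall x, extend0 Psi t @[t --> x^'+] --> extend0 Psi x.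
Proof.
move=> x; have [x0|x0|->] := ltgtP x 0.
- rewrite {2}/extend0 ltNge (ltW x0)/=; apply: cvg_near_cst.
  near=> y; rewrite /extend0; suff -> : (0 < y) = false by [].
  by apply/negbTE; rewrite -leNgt ltW//; near: y; exact: nbhs_right_lt.
- have [dx _] := Psi_C1 x0.
  have cx : {for x, continuous Psi}.
    by apply: differentiable_continuous; exact/derivable1_diffP.
  rewrite {2}/extend0 x0; apply: cvg_trans (cvg_at_right_filter cx).
  apply: near_eq_cvg; near=> y; rewrite /extend0 ifT//.
  by apply: lt_trans x0 _; near: y; exact: nbhs_right_gt.
- rewrite {2}/extend0 ltxx; apply/cvgrPdist_lt => e e0.
  have [_ [s /= + <-] se] := inf_adherent e0 A_inf.
  rewrite in_itv/= andbT => s0; near=> y.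
  have y0 : 0 < y by near: y; exact: nbhs_right_gt.
  have ys : y < s by near: y; exact: nbhs_right_lt.
  rewrite /extend0 y0 distrC ger0_norm ?subr_ge0 ?inf_le// ltrBlDl.
  apply: le_lt_trans se; apply: Psi_incr; rewrite ?in_itv/= ?andbT//.
  exact: ltW.
Unshelve. all: by end_near. Qed.

HB.instance Definition _ := isCumulative.Build R _ R (extend0 Psi)
  extend0_nondecreasing extend0_right_continuous.

(** The set function [stieltjes Psi] is a measure because the extension of Psi is
nondecreasing and right-continuous. *)
Lemma stieltjesE : exists M : {measure set (measurableTypeR R) -> \bar R},
  stieltjes Psi = M /\ forall a b, 0 < a -> a <= b ->
    M `]a, b]%classic = (Psi b - Psi a)%:E.
Proof.
exists (lebesgue_stieltjes_measure (extend0 Psi)); split => // a b a0 ab.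
transitivity (((wlength (extend0 Psi))^*)%mu `]a, b]%classic); first by [].
rewrite measurable_mu_extE//; last exact: is_ocitv.
transitivity (wlength (extend0 Psi) `]a, b]%classic); first by [].
by rewrite wlength_itv_bnd// /extend0 a0 (lt_le_trans a0 ab).
Qed.

End stieltjes_measure_of_Psi.

Section dyadic_sum_bound.
Context {R : realType}.
Local Open Scope ereal_scope.

(** The points 2^(j - N), written without integer exponents; for j between 0 and
2 N they run from 2^-N to 2^N. *)
Definition dyadic (N j : nat) : R := (2^-1 ^+ N * 2 ^+ j)%R.

Lemma dyadic_gt0 N j : (0 < dyadic N j)%R.
Proof. by rewrite mulr_gt0// exprn_gt0// invr_gt0. Qed.

Lemma dyadicS N j : dyadic N j.+1 = (2 * dyadic N j)%R.
Proof. by rewrite /dyadic exprS mulrCA. Qed.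

Lemma dyadic_lt N i j : (i < j)%N -> (2 * dyadic N i <= dyadic N j)%R.
Proof.
move=> ij; rewrite -dyadicS /dyadic ler_wpM2l ?exprn_ge0 ?invr_ge0//.
by rewrite ler_eXn2l// ltr1n.
Qed.

Lemma dyadic_nd N i j : (i <= j)%N -> (dyadic N i <= dyadic N j)%R.
Proof.
move=> ij; rewrite /dyadic ler_wpM2l ?exprn_ge0 ?invr_ge0//.
by rewrite ler_eXn2l// ltr1n.
Qed.

(** The superlevel sets are intervals. *)
Lemma nonincreasing_measurable (c : measurableTypeR R -> \bar R) :
  (forall s t : R, (0 < s)%R -> (s <= t)%R -> c t <= c s) ->
  measurable_fun (`]0%R, +oo[%classic : set (measurableTypeR R)) c.
Proof.
move=> cni mD; apply: (measurability _ (ErealGenOInfty.measurableE R)) => // _ [_ [x ->] <-].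
apply: is_interval_measurable => s t /= [s0 xs] [t0 xt] z /andP[sz zt].
move: s0 xs t0 xt; rewrite !in_itv/= !andbT => s0 xs t0 xt.
have z0 : (0 < z)%R by exact: lt_le_trans sz.
by split; rewrite ?in_itv/= ?andbT//; apply: lt_le_trans xt _; exact: cni.
Qed.

(** On each dyadic interval c is at most its value at the left end point; let N tend
to infinity. *)
Lemma integral_dyadic_le (M : {measure set (measurableTypeR R) -> \bar R})
    (c : measurableTypeR R -> \bar R) (X : \bar R) :
  (forall t, 0 <= c t) -> (forall s t : R, (0 < s)%R -> (s <= t)%R -> c t <= c s) ->
  (forall N, \sum_(j < N.*2) c (dyadic N j) *
     M `]dyadic N j, dyadic N j.+1]%classic <= X) ->
  \int[M]_(t in `]0%R, +oo[) c t <= X.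
Proof.
move=> c0 cni HX.
have mc := nonincreasing_measurable cni.
have sub a b : (0 <= a)%R -> `]a, b]%classic `<=` (`]0%R, +oo[%classic : set R).
  move=> a0 x /=; rewrite !in_itv/= andbT => /andP[ax _]; exact: le_lt_trans ax.
have mci a b : (0 <= a)%R -> measurable_fun (`]a, b]%classic : set (measurableTypeR R)) c.
  by move=> a0; apply: measurable_funS mc => //; exact: sub.
have piece N p : \int[M]_(t in `]dyadic N 0, dyadic N p]) c t <=
    \sum_(j < p) c (dyadic N j) * M `]dyadic N j, dyadic N j.+1]%classic.
  elim: p => [|p IH].
    by rewrite big_ord0 set_itvoc0 integral_set0.
  rewrite big_ord_recr/=.
  have -> : `]dyadic N 0, dyadic N p.+1]%classic =
      `]dyadic N 0, dyadic N p]%classic `|` `]dyadic N p, dyadic N p.+1]%classic.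
    by rewrite -itv_bndbnd_setU// bnd_simp dyadic_nd.
  rewrite ge0_integral_setU//; last 2 first.
  - rewrite -itv_bndbnd_setU ?bnd_simp ?dyadic_nd//.
    by apply: mci; rewrite ltW// dyadic_gt0.
  - apply/disj_setPS => x [/=]; rewrite !in_itv/= => /andP[_ h1] /andP[h2 _].
    by move: (lt_le_trans h2 h1); rewrite ltxx.
  apply: leeD => //.
  apply: (@le_trans _ _ (\int[M]_(t in `]dyadic N p, dyadic N p.+1]) cst (c (dyadic N p)) t)).
    apply: ge0_le_integral => //.
    - by apply: mci; rewrite ltW// dyadic_gt0.
    - move=> t /=; rewrite in_itv/= => /andP[t1 _].
      by apply: cni; [exact: dyadic_gt0|exact: ltW].
  by rewrite integral_cst.
have bigE : `]0%R, +oo[%classic = \bigcup_N `]dyadic N 0, dyadic N N.*2]%classic :> set R.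
  apply/seteqP; split => [x /=|x [N _]]; last first.
    by apply: sub; rewrite ltW// dyadic_gt0.
  rewrite in_itv/= andbT => x0.
  pose N := maxn (Num.bound x) (Num.bound x^-1).
  exists N => //=; rewrite in_itv/= /dyadic expr0 mulr1 exprVn.
  have n2 k : (k%:R < 2 ^+ k :> R)%R by rewrite -natrX ltr_nat ltn_expl.
  apply/andP; split.
    rewrite invf_plt ?posrE ?exprn_gt0//.
    apply: lt_trans (n2 N); apply: lt_le_trans (archi_boundP _) _.
      by rewrite invr_ge0 ltW.
    by rewrite ler_nat leq_maxr.
  rewrite -addnn exprD mulKf ?gt_eqF ?exprn_gt0//.
  apply/ltW/(lt_trans _ (n2 N))/(lt_le_trans (archi_boundP (ltW x0))).
  by rewrite ler_nat leq_maxl.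
rewrite bigE.
have nd : nondecreasing_seq (fun N =>
    `]dyadic N 0, dyadic N N.*2]%classic : set (measurableTypeR R)).
  apply/nondecreasing_seqP => N; apply/subsetPset => x /=.
  rewrite !in_itv/= => /andP[x1 x2]; apply/andP; split.
    apply: le_lt_trans x1; rewrite /dyadic !expr0 !mulr1 exprS.
    by rewrite ler_piMl ?exprn_ge0 ?invr_ge0// invf_le1// ler1n.
  apply: le_trans x2 _; rewrite /dyadic doubleS !exprS.
  have h : (0 <= 2^-1 ^+ N * 2 ^+ N.*2 :> R)%R by rewrite mulr_ge0 ?exprn_ge0 ?invr_ge0.
  rewrite [leRHS](_ : _ = 2 * (2^-1 ^+ N * 2 ^+ N.*2))%R; last by field.
  by rewrite ler_peMl// ler1n.
have cv := @ge0_nondecreasing_set_cvg_integral _ _ _ _ c M nd.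
rewrite -(cvg_lim _ (cv _ _ _))//.
- apply: lime_le; first by apply/cvg_ex; eexists; apply: cv => //;
    move=> i; apply: mci; rewrite ltW// dyadic_gt0.
  by apply: nearW => N; exact: le_trans (piece _ _) (HX N).
- by move=> i; apply: mci; rewrite ltW// dyadic_gt0.
Qed.

End dyadic_sum_bound.

(** * Summation over the dyadic levels *)

Section dyadic_cuts.
Context {R : realType} {n : nat}.
Variables (Phi Psi : R -> R) (A : R).
Hypotheses (Phi_young : young Phi) (Phi_doubling : doubling Phi).
Hypothesis Psi_ge0 : forall t, 0 < t -> 0 <= Psi t.
Hypothesis A_ge0 : 0 <= A.
Hypothesis PhiPsi : forall a b, 0 < a -> 0 < b -> Phi a * Psi b <= A * Phi (a * b).
Implicit Types F : 'rV[R]_n -> R.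

Lemma gradient_level_cut (t : R) F x : smooth F -> gradient (level_cut t F) x =
  (t^-1 * (dstep (t^-1 * F x) - dstep (- t^-1 * F x))) *: gradient F x.
Proof.
move=> sF.
have sZ (c : R) : smooth ((fun=> c) \* F) by exact: smoothM (smooth_cst c) sF.
have sS (c : R) : smooth (step \o ((fun=> c) \* F)) by exact: smooth_comp_step (sZ c).
have E (c : R) : gradient (step \o ((fun=> c) \* F)) x =
    (dstep (c * F x) * c) *: gradient F x.
  by have -> := gradient_comp (sZ c) (is_derive_step _); rewrite (gradientZ c x sF) scalerA.
refine (etrans (gradientD x (sS t^-1) (sS (- t^-1))) _).
refine (etrans (congr2 +%R (E t^-1) (E (- t^-1))) _).
by rewrite -scalerDl; congr (_ *: _); ring.
Qed.

(** Outside the shell both arguments of the step function lie in the region where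
its derivative vanishes. *)
Lemma gradient_level_cut_eq0 (t : R) F x : smooth F -> 0 < t ->
  ~~ (t / 8 < `|F x| < t / 4) -> gradient (level_cut t F) x = 0.
Proof.
move=> sF t0 nF; rewrite gradient_level_cut//.
suff [-> ->] : dstep (t^-1 * F x) = 0 /\ dstep (- t^-1 * F x) = 0.
  by rewrite subrr mulr0 scale0r.
move: nF; rewrite negb_and -!leNgt => /orP[F8|F4].
  move: F8; rewrite ler_norml => /andP[h1 h2].
  split; apply: dstep_eq0; left; first by rewrite ler_pdivrMl.
  by rewrite mulNr lerNl -ler_pdivrMl ?invr_gt0// invrK mulrN.
move: F4; rewrite ler_normr => /orP[] h; split; apply: dstep_eq0.
- by right; rewrite ler_pdivlMl.
- left; rewrite mulNr lerNl (@le_trans _ _ 0)// ?oppr_le0 ?invr_ge0//.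
  by rewrite mulr_ge0 ?invr_ge0 ?(ltW t0)// (le_trans _ h)// divr_ge0// ltW.
- left; rewrite (@le_trans _ _ 0) ?invr_ge0//.
  have F0 : F x <= 0 by rewrite -oppr_ge0 (le_trans _ h)// divr_ge0// ltW.
  by rewrite mulr_ge0_le0// invr_ge0 ltW.
- by right; rewrite mulNr -mulrN ler_pdivlMl.
Qed.

(** At a given x at most one shell contains |F x|, so at most one term is nonzero.
For that one, |grad (level_cut t F)| <= 2 L |grad F| / t = 4 L |grad F| / (2 t),
where L bounds the derivative of the step;
the doubling condition removes 4 L, and Psi(2 t) Phi(a / (2 t)) <= A Phi(a). *)
Lemma sum_level_cut_le : exists2 K : R, 0 <= K & forall (N m : nat) F x, smooth F ->
  \sum_(j < m) Psi (dyadic N j.+1) * Phi (enorm (gradient (level_cut (dyadic N j) F) x))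
    <= K * Phi (enorm (gradient F x)).
Proof.
have [L L0 HL] := @dstep_bounded R.
have [D D0 HD] := young_dilation Phi_young Phi_doubling (mulr_ge0 (ler0n R 4) (ltW L0)).
exists (D * A) => [|N m F x sF]; first by rewrite mulr_ge0// ltW.
have P0 e : 0 <= e -> 0 <= Phi e by exact: young_ge0.
have e0 := enorm_ge0 (gradient F x).
have zero j : ~~ (dyadic N j / 8 < `|F x| < dyadic N j / 4) ->
    Psi (dyadic N j.+1) * Phi (enorm (gradient (level_cut (dyadic N j) F) x)) = 0.
  move=> nj; rewrite gradient_level_cut_eq0// ?dyadic_gt0//.
  by rewrite enorm0 young0// mulr0.
have [[j Hj]|nj] := pselect (exists j : 'I_m, dyadic N j / 8 < `|F x| < dyadic N j / 4); last first.
  rewrite big1; first by rewrite !mulr_ge0// ?P0// ltW.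
  by move=> j _; apply: zero; apply/negP => Hj; apply: nj; exists j.
rewrite (bigD1 j)//= big1 ?addr0; last first.
  move=> i ij; apply: zero; apply/negP => Hi.
  have /orP[lt|lt] : (i < j)%N || (j < i)%N by rewrite -neq_ltn.
  - have := @dyadic_lt R N _ _ lt; move: Hi Hj => /andP[i1 i2] /andP[j1 j2]; lra.
  - have := @dyadic_lt R N _ _ lt; move: Hi Hj => /andP[i1 i2] /andP[j1 j2]; lra.
have t0 := @dyadic_gt0 R N j; have t1 := @dyadic_gt0 R N j.+1.
have [e00|en0] := eqVneq (enorm (gradient F x)) 0.
  by rewrite gradient_level_cut// enormZ e00 mulr0 (young0 Phi_young) !mulr0.
have epos : 0 < enorm (gradient F x) by rewrite lt0r en0.
have q0 : 0 < enorm (gradient F x) / dyadic N j.+1 by rewrite divr_gt0.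
apply: (@le_trans _ _ (Psi (dyadic N j.+1) * (D * Phi (enorm (gradient F x) / dyadic N j.+1)))).
  rewrite ler_wpM2l ?Psi_ge0//; apply: le_trans (HD _ (ltW q0)).
  apply: (young_le Phi_young); first exact: enorm_ge0.
  rewrite gradient_level_cut// enormZ normrM gtr0_norm ?invr_gt0//.
  have := HL ((dyadic N j)^-1 * F x); have := HL (- (dyadic N j)^-1 * F x) => h1 h2.
  have h3 := le_trans (ler_normB (dstep ((dyadic N j)^-1 * F x))
    (dstep (- (dyadic N j)^-1 * F x))) (lerD h2 h1).
  rewrite dyadicS [leRHS](_ : _ = (dyadic N j)^-1 * (L + L) * enorm (gradient F x)).
    by rewrite ler_wpM2r// ler_wpM2l// invr_ge0 ltW.
  by field; rewrite gt_eqF.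
have := PhiPsi q0 t1; rewrite divfK ?gt_eqF// => h.
rewrite mulrCA -mulrA ler_wpM2l ?(ltW D0)//; apply: le_trans h.
by rewrite mulrC.
Qed.

End dyadic_cuts.

(** * The capacitary strong type inequality *)

Section capacitary_inequality.
Context {R : realType} {n : nat}.
Variable Phi : R -> R.
Hypotheses (Phi_young : young Phi) (Phi_doubling : doubling Phi).
Local Open Scope ereal_scope.

Notation energy r v := (\int[lebesgue]_(x in eball n r) (Phi (enorm (gradient v x)))%:E).

Lemma capacity_ge0 (r : R) (E : set 'rV[R]_n) : 0 <= capacity Phi r E.
Proof.
apply: le_ereal_inf_tmp => _ [v _ <-]; apply: integral_ge0 => x _.
exact: er_young_ge0.
Qed.

Lemma le_capacity (r : R) (E E' : set 'rV[R]_n) : E `<=` E' ->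
  capacity Phi r E <= capacity Phi r E'.
Proof.
move=> EE'; apply: ereal_inf_le_tmp => _ [v [Bv vE'] <-]; exists v => //.
by split => // x /EE'; exact: vE'.
Qed.

Lemma measurable_energy (D : set (Rspace R n)) (w : 'rV[R]_n -> R) : smooth w ->
  measurable_fun D (fun x : Rspace R n => (Phi (enorm (gradient w x)))%:E).
Proof.
move=> sw; apply: (measurable_young_continuous Phi_young (g := fun x => enorm (gradient w x))).
  by move=> x; exact: enorm_ge0.
exact: continuous_enorm_gradient.
Qed.

Lemma enorm_le_dist (x y : 'rV[R]_n) : (enorm y <= enorm x + enorm (x - y))%R.
Proof.
have := ler_enormD x ((-1) *: (x - y))%R; rewrite enormZ normrN1 mul1r.
by rewrite scaleN1r opprB addrCA subrr addr0.
Qed.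

Lemma measurable_young_enorm (D : set (Rspace R n)) (g : Rspace R n -> 'rV[R]_n) :
  (forall i, measurable_fun D (fun x => g x ord0 i)) ->
  measurable_fun D (fun x => (Phi (enorm (g x)))%:E).
Proof.
move=> mg; exact: (@measurable_young R Phi Phi_young _ (Rspace R n) D
  (fun x => enorm (g x)) (fun x => enorm_ge0 _) (measurable_enorm mg)).
Qed.

(** Phi(a + b) <= D (Phi(a) + Phi(b)) with a = |Du| and b = |Du - grad F|. *)
Lemma energy_triangle : exists2 D : R, (0 < D)%R &
  forall (r : R) (Du : 'rV[R]_n -> 'rV[R]_n) (F : 'rV[R]_n -> R), smooth F ->
  (forall i, measurable_fun (eball n r : set (Rspace R n))
     ((fun x => Du x ord0 i) : Rspace R n -> R)) ->
  energy r F <= D%:E *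
    (\int[lebesgue]_(x in eball n r) (Phi (enorm (Du x)))%:E +
     \int[lebesgue]_(x in eball n r) (Phi (enorm (Du x - gradient F x)%R))%:E).
Proof.
have [D D0 HD] := youngD_le Phi_young Phi_doubling.
exists D => // r Du F sF mDu.
have mB : measurable (eball n r : set (Rspace R n)).
  by apply: open_measurable_Rspace; exact: open_eball.
have P0 (y : 'rV[R]_n) : 0 <= (Phi (enorm y))%:E.
  by rewrite lee_fin; apply: young_ge0 => //; exact: enorm_ge0.
have m1 : measurable_fun (eball n r : set (Rspace R n))
    (fun x : Rspace R n => (Phi (enorm (Du x)))%:E) by exact: measurable_young_enorm.
have m2 : measurable_fun (eball n r : set (Rspace R n))
    (fun x : Rspace R n => (Phi (enorm (Du x - gradient F x)%R))%:E).
  apply: measurable_young_enorm => i; rewrite (_ : (fun x => _) =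
      (fun x : Rspace R n => Du x ord0 i - gradient F x ord0 i)%R).
    by apply: measurable_funB; [exact: mDu|exact: measurable_gradient_coord].
  by apply/funext => x; rewrite !mxE.
have mS : measurable_fun (eball n r : set (Rspace R n)) (fun x : Rspace R n =>
    (Phi (enorm (Du x)))%:E + (Phi (enorm (Du x - gradient F x)%R))%:E).
  exact: emeasurable_funD m1 m2.
rewrite -(@ge0_integralD _ _ _ lebesgue _ mB _ _ (fun x _ => P0 (Du x)) m1
  (fun x _ => P0 (Du x - gradient F x)%R) m2).
rewrite -(@ge0_integralZl_EFin _ _ _ lebesgue _ mB _ _ mS); last 2 first.
- by move=> x _; rewrite adde_ge0.
- exact: ltW.
refine (@ge0_le_integral _ _ _ lebesgue _ mB _ _ (fun x _ => P0 (gradient F x))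
  (@measurable_energy (eball n r) F sF) (measurable_funeM _ mS) _) => x _.
rewrite -EFinD -EFinM lee_fin.
apply: le_trans (HD _ _ (enorm_ge0 _) (enorm_ge0 _)).
apply: (young_le Phi_young); first exact: enorm_ge0.
exact: enorm_le_dist.
Qed.

(** The pointwise bound on the sum, integrated. *)
Lemma sum_energy_le (r K : R) (m : nat) (a : 'I_m -> R) (g : 'I_m -> 'rV[R]_n -> R)
    (F : 'rV[R]_n -> R) : (0 <= K)%R -> (forall j, 0 <= a j)%R ->
  (forall j, smooth (g j)) -> smooth F ->
  (forall x, \sum_(j < m) a j * Phi (enorm (gradient (g j) x)) <=
     K * Phi (enorm (gradient F x)))%R ->
  \sum_(j < m) (a j)%:E * energy r (g j) <= K%:E * energy r F.
Proof.
move=> K0 a0 sg sF H.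
have mB : measurable (eball n r : set (Rspace R n)).
  by apply: open_measurable_Rspace; exact: open_eball.
have P0 (w : 'rV[R]_n -> R) x : 0 <= (Phi (enorm (gradient w x)))%:E.
  by rewrite lee_fin; apply: young_ge0 => //; exact: enorm_ge0.
have mg j := @measurable_energy (eball n r) (g j) (sg j).
rewrite -(@ge0_integralZl_EFin _ _ _ lebesgue _ mB _ (fun x _ => P0 F x)
  (@measurable_energy (eball n r) F sF))//.
rewrite (eq_bigr (fun j => \int[lebesgue]_(x in eball n r)
    ((a j)%:E * (Phi (enorm (gradient (g j) x)))%:E))); last first.
  move=> j _; symmetry.
  exact: (@ge0_integralZl_EFin _ _ _ lebesgue _ mB _ (fun x _ => P0 (g j) x) (mg j)).
have ma j := measurable_funeM (a j)%:E (mg j).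
have aP0 j x : eball n r x -> 0 <= (a j)%:E * (Phi (enorm (gradient (g j) x)))%:E.
  by move=> _; rewrite mule_ge0// lee_fin.
rewrite -(@ge0_integral_sum _ _ _ lebesgue _ mB _ _ ma aP0).
have h0 x : eball n r x -> 0 <= \sum_(j < m) ((a j)%:E * (Phi (enorm (gradient (g j) x)))%:E).
  by move=> Bx; apply: sume_ge0 => j _; exact: aP0.
refine (@ge0_le_integral _ _ _ lebesgue _ mB _ _ h0 (emeasurable_sum _ ma)
  (measurable_funeM _ (@measurable_energy (eball n r) F sF)) _) => x _.
rewrite -EFinM (eq_bigr (fun j => (a j * Phi (enorm (gradient (g j) x)))%:E))//.
by rewrite sumEFin lee_fin.
Qed.

Lemma finite_min_pos (m : nat) (P : nat -> R -> Prop) :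
  (forall j a b, 0 < a -> a <= b -> P j b -> P j a)%R ->
  (forall j, exists2 a, 0 < a & P j a)%R ->
  exists2 a : R, (0 < a)%R & forall j, (j < m)%N -> P j a.
Proof.
move=> Pmono Pex; elim: m => [|m [a a0 Ha]]; first by exists 1%R.
have [b b0 Hb] := Pex m; exists (Num.min a b); first by rewrite lt_min a0.
have ab0 : (0 < Num.min a b)%R by rewrite lt_min a0.
move=> j; rewrite ltnS leq_eqVlt => /predU1P[->|jm].
  by apply: Pmono Hb => //; rewrite ge_min lexx orbT.
by apply: Pmono (Ha _ jm) => //; rewrite ge_min lexx.
Qed.

End capacitary_inequality.

Theorem theorem1p2 (R : realType) (n : nat) (n_ge2 : (2 <= n)%N)
    (Phi Psi f phi psi : R -> R) (C r : R)
    (Phi_young : young Phi)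
    (Psi_incr : {in `]0, +oo[ &, {homo Psi : s t / s <= t}})
    (Psi_C1 : C1_pos Psi)
    (f_ge0 : forall t : R, 0 <= t -> 0 <= f t)
    (phi_ge0 : forall t : R, 0 <= t -> 0 <= phi t)
    (psi_gt0 : forall t : R, 0 < t -> 0 < psi t)
    (f_doubling : doubling f)
    (phi_doubling : doubling phi)
    (PhiE : forall t : R, 0 <= t -> Phi t = f t * phi t)
    (PsiE : forall t : R, 0 < t -> Psi t = f t * psi t)
    (f_mul : forall s t : R, 0 < s -> 0 < t -> f s * f t <= C * f (s * t))
    (phi_psi_mul : forall s t : R, 0 < s -> 0 < t ->
       phi s * psi t <= C * phi (s * t))
    (r_gt0 : 0 < r) :
  exists K : R, forall (u : 'rV[R]_n -> \bar R) (Du : 'rV[R]_n -> 'rV[R]_n),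
    W10 Phi (eball n r) u Du ->
    quasicontinuous Phi r u ->
    (\int[stieltjes Psi]_(t in `]0%R, +oo[)
        capacity Phi r [set x | eball n r x /\ t%:E < `|u x|]
     <= K%:E *
        \int[lebesgue]_(x in eball n r) (Phi (enorm (Du x)))%:E)%E.
Proof.
have Psi_ge0 t : 0 < t -> 0 <= Psi t.
  by move=> t0; rewrite PsiE// mulr_ge0 ?f_ge0 ?(ltW t0)// ltW// psi_gt0.
have Phi_doubling : doubling Phi.
  have [D1 D10 H1] := f_doubling; have [D2 D20 H2] := phi_doubling.
  exists (D1 * D2) => [|t t0]; first exact: mulr_gt0.
  have t20 : 0 <= 2 * t by rewrite mulr_ge0.
  rewrite !PhiE// mulrACA ler_pM ?f_ge0 ?phi_ge0//; [exact: H1|exact: H2].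
have PhiPsi a b : 0 < a -> 0 < b -> Phi a * Psi b <= C ^+ 2 * Phi (a * b).
  move=> a0 b0; have ab0 : 0 <= a * b by rewrite mulr_ge0 ?ltW.
  rewrite PhiE ?(ltW a0)// PsiE// PhiE// mulrACA expr2 [leRHS]mulrACA.
  rewrite ler_pM ?mulr_ge0 ?f_ge0 ?phi_ge0 ?(ltW a0) ?(ltW b0) ?(ltW (psi_gt0 _ _))//.
  - exact: f_mul.
  - exact: phi_psi_mul.
have [M [-> Mab]] := stieltjesE Psi_incr Psi_C1 Psi_ge0.
have [D D0 HD] := @capacity_level_le R n Phi Phi_young Phi_doubling.
have [K1 K10 HK1] := @sum_level_cut_le R n Phi Psi _ Phi_young Phi_doubling Psi_ge0
  (sqr_ge0 C) PhiPsi.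
have [D' D'0 HD'] := @energy_triangle R n Phi Phi_young Phi_doubling.
exists (D * K1 * D') => u Du Wu qu.
have [[[mu _] _ mDu _] _] := Wu.
set X := (\int[lebesgue]_(x in eball n r) (Phi (enorm (Du x)))%:E)%E.
apply: integral_dyadic_le.
- by move=> t; exact: capacity_ge0.
- move=> s t s0 st; apply: le_capacity => x [Bx xt]; split => //.
  by apply: le_lt_trans xt; rewrite lee_fin.
move=> N; apply/lee_addgt0Pr => e e0.
(* Each half of e absorbs one error: e1 occurs on every level, with total weight
   D S, and e2 bounds the energy of u - F. *)
pose P (j : 'I_N.*2) := Psi (dyadic N j.+1).
have P0 j : 0 <= P j by apply: Psi_ge0; exact: dyadic_gt0.
pose S := \sum_(j < N.*2) P j.
have S0 : 0 <= S by apply: sumr_ge0.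
have DS0 : 0 < D * S + 1 by rewrite ltr_wpDl// mulr_ge0// ltW.
have DK0 : 0 < D * K1 * D' + 1 by rewrite ltr_wpDl// !mulr_ge0// ltW.
pose e1 := e / 2 / (D * S + 1).
have e10 : 0 < e1 by rewrite !divr_gt0.
pose e2 := e / 2 / (D * K1 * D' + 1).
have e20 : 0 < e2 by rewrite !divr_gt0.
have [eta eta0 Heta] := @finite_min_pos R N.*2 (fun j a =>
    forall F, Cc_infty (eball n r) F ->
    (\int[lebesgue]_(x in eball n r) `|u x - (F x)%:E| <= a%:E)%E ->
    (capacity Phi r [set x | eball n r x /\ (dyadic N j)%:E < `|u x|] <=
      D%:E * (\int[lebesgue]_(x in eball n r)
        (Phi (enorm (gradient (level_cut (dyadic N j) F) x)))%:E + e1%:E))%E)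
  (fun j a b _ ab H F BF HF => H F BF (le_trans HF (ab : (a%:E <= b%:E)%E)))
  (fun j => HD r _ e1 u r_gt0 (dyadic_gt0 N j) e10 mu qu).
have eta20 : 0 < Num.min eta e2 by rewrite lt_min eta0.
have [F [BF HF1 HF2]] := W10_approx Phi_young r_gt0 Wu eta20.
have sF := Cc_smooth BF.
have {}HF1 : (\int[lebesgue]_(x in eball n r) `|u x - (F x)%:E| <= eta%:E)%E.
  by apply: le_trans HF1 _; rewrite lee_fin ge_min lexx.
have {}HF2 : (\int[lebesgue]_(x in eball n r)
    (Phi (enorm (Du x - gradient F x)%R))%:E <= e2%:E)%E.
  by apply: le_trans HF2 _; rewrite lee_fin ge_min lexx orbT.
pose E (j : 'I_N.*2) := (\int[lebesgue]_(x in eball n r)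
        (Phi (enorm (gradient (level_cut (dyadic N j) F) x)))%:E)%E.
have E0 j : (0 <= E j)%E.
  by apply: integral_ge0 => x _; rewrite lee_fin (young_ge0 Phi_young)// enorm_ge0.
have X0 : (0 <= X)%E.
  by apply: integral_ge0 => x _; rewrite lee_fin (young_ge0 Phi_young)// enorm_ge0.
apply: (@le_trans _ _ (D%:E * \sum_(j < N.*2) ((P j)%:E * E j + (e1 * P j)%:E))%E).
  rewrite ge0_sume_distrr; last first.
    move=> j _; apply: adde_ge0; first by apply: mule_ge0; [rewrite lee_fin; exact: P0|exact: E0].
    by rewrite lee_fin mulr_ge0// ltW.
  apply: lee_sum => j _; rewrite Mab ?dyadic_gt0 ?dyadic_nd//.
  apply: (@le_trans _ _ (D%:E * (E j + e1%:E) * (P j)%:E)%E).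
    apply: lee_pmul.
    - exact: capacity_ge0.
    - by rewrite lee_fin subr_ge0 Psi_incr ?in_itv/= ?andbT ?dyadic_gt0 ?dyadic_nd.
    - exact: Heta.
    - by rewrite lee_fin gerBl Psi_ge0// dyadic_gt0.
  rewrite -muleA ge0_muleDl ?lee_fin ?(ltW e10)//.
  by rewrite [(E j * _)%E]muleC.
rewrite big_split/= sumEFin -mulr_sumr -/S.
have energy_sum := sum_energy_le Phi_young r K10 P0
  (fun j => Cc_smooth (Cc_level_cut (dyadic N j) BF)) sF (fun x => HK1 N N.*2 F x sF).
have energy_F := HD' r Du F sF mDu.
apply: (@le_trans _ _ (D%:E * (K1%:E * (D'%:E * (X + e2%:E)) + (e1 * S)%:E))%E).
  rewrite lee_wpmul2l ?lee_fin ?(ltW D0)// leeD2r//.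
  apply: le_trans energy_sum _; rewrite lee_wpmul2l ?lee_fin//.
  apply: le_trans energy_F _; rewrite lee_wpmul2l ?lee_fin ?(ltW D'0)//.
  by rewrite leeD2l.
have e1S : (0 <= (e1 * S)%:E)%E by rewrite lee_fin mulr_ge0// ltW.
have e2_ge0 : (0 <= e2%:E)%E by rewrite lee_fin ltW.
have Y0 : (0 <= K1%:E * (D'%:E * (X + e2%:E)))%E.
  apply: mule_ge0; first by rewrite lee_fin.
  by apply: mule_ge0; [rewrite lee_fin ltW|exact: adde_ge0].
rewrite (ge0_muleDr _ Y0 e1S) !muleA -!EFinM (ge0_muleDr _ X0 e2_ge0) -addeA leeD2l//.
rewrite -EFinM -EFinD lee_fin.
have half Q : 0 <= Q -> Q * (e / 2 / (Q + 1)) <= e / 2.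
  move=> Q0; rewrite mulrA ler_pdivrMr ?ltr_wpDl// mulrC ler_wpM2l ?lerDl//.
  by rewrite divr_ge0// ltW.
have h1 : D * K1 * D' * e2 <= e / 2 by apply: half; rewrite !mulr_ge0// ltW.
have h2 : D * (e1 * S) <= e / 2.
  by rewrite mulrA mulrAC; apply: half; rewrite mulr_ge0// ltW.
by rewrite [leRHS]splitr lerD.
Qed.
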